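(* Let $\widetilde{Q}$ be a quiver composed of full connected subquivers $Q, Q^1,\dots,Q^k$ satisfying: (1) $Q^i_0\cap Q_0=\{x_i\}$ for each $i$; (2) $Q^i_0\cap Q^j_0=\{x_i\}$ if $x_i=x_j$ and $Q^i_0\cap Q^j_0=\varnothing$ otherwise ($i\ne j$); (3) for every arrow of $\widetilde Q$, if one endpoint lies in $Q^i_0\setminus\{x_i\}$ then the other endpoint lies in $Q^i_0$; (4) each $Q^i$ is of mutation type $\mathbb{A}$. Let $\mu_Q$ be a maximal green sequence of $Q$ and let $l^i_{\min}$ be the minimal length of a maximal green sequence of $Q^i$. Then $\widetilde{Q}$ admits a maximal green sequence of length $\ell(\mu_Q)+l^1_{\min}+\cdots+l^k_{\min}-k$.
   Context: A quiver is a finite directed graph with no loops or oriented 2-cycles; ''composed of'' means $\widetilde Q_0=Q_0\cup\bigcup_i Q^i_0$ (the vertices $x_i$ need not be distinct). Mutation $\mu_k$: (1) for every path $i\to k\to j$ add an arrow $i\to j$; (2) reverse all arrows incident to $k$; (3) remove a maximal collection of oriented 2-cycles, and arrows between two frozen vertices. A quiver is of mutation type $\mathbb{A}$ if it is obtainable by mutations from an orientation of a path with the same number of vertices. The framed quiver $\widehat Q$ has an additional frozen vertex $i'$ and arrow $i\to i'$ for each vertex $i$; only mutable vertices are mutated. A mutable vertex $i$ of a quiver obtained from $\widehat Q$ by mutations is green if there is no arrow $j'\to i$ from a frozen vertex and red if there is no arrow $i\to j'$ to a frozen vertex. A maximal green sequence of $Q$ is a sequence $(i_1,\dots,i_r)$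 of mutable vertices such that each $i_j$ is green in $\mu_{i_{j-1}}\cdots\mu_{i_1}(\widehat Q)$ and all mutable vertices are red in $\mu_{i_r}\cdots\mu_{i_1}(\widehat Q)$; its length $\ell$ is $r$. *)

(* Defs.v *)
From HB Require Import structures.
From mathcomp Require Import all_boot.
Set Implicit Arguments.
Unset Strict Implicit.
Unset Printing Implicit Defensive.

(* [Q i j] is the number of arrows [i -> j]: quivers are multigraphs, taken up
   to renaming of parallel arrows. *)
Record quiver (V : finType) := Quiver {
  arrows :> V -> V -> nat;
  no_loop : forall i, arrows i i = 0;
  no_2cycle : forall i j, arrows i j = 0 \/ arrows j i = 0
}.

Section Mutation.
Variables (V : finType) (frozen : pred V).
Implicit Types (a : V -> V -> nat) (k : V).

Definition add_paths k a i j := a i j + a i k * a k j.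

Definition reverse_at k a i j :=
  if (i == k) || (j == k) then a j i else a i j.

(* A maximal collection of 2-cycles between [i] and [j] consists of
   [minn (a i j) (a j i)] of them; what remains of the arrows [i -> j] is the
   truncated difference. *)
Definition reduce a i j :=
  if frozen i && frozen j then 0 else a i j - a j i.

Definition mutate_arrows k a := reduce (reverse_at k (add_paths k a)).

Lemma mutate_no_loop k a i : mutate_arrows k a i i = 0.
Proof. by rewrite /mutate_arrows /reduce subnn if_same. Qed.

Lemma mutate_no_2cycle k a i j :
  mutate_arrows k a i j = 0 \/ mutate_arrows k a j i = 0.
Proof.
rewrite /mutate_arrows; move: (reverse_at _ _) => b; rewrite /reduce.
rewrite [frozen j && _]andbC; case: ifP => _; first by left.
case/orP: (leq_total (b i j) (b j i)); rewrite -subn_eq0 => /eqP; by auto.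
Qed.

Definition mutate (Q : quiver V) k : quiver V :=
  Quiver (mutate_no_loop k Q) (mutate_no_2cycle k Q).

Definition mutates (Q : quiver V) (s : seq V) : quiver V := foldl mutate Q s.

End Mutation.

Section Full.
Variables (V : finType) (Q : quiver V) (S : {set V}).

Definition full_arrows (i j : {x : V | x \in S}) := Q (val i) (val j).

Lemma full_no_loop i : full_arrows i i = 0.
Proof. exact: no_loop. Qed.

Lemma full_no_2cycle i j : full_arrows i j = 0 \/ full_arrows j i = 0.
Proof. exact: no_2cycle. Qed.

Definition full_subquiver : quiver {x : V | x \in S} :=
  Quiver full_no_loop full_no_2cycle.

End Full.

Definition adjacent (V : finType) (Q : quiver V) : rel V :=
  fun i j => (0 < Q i j) || (0 < Q j i).

Definition connected_quiver (V : finType) (Q : quiver V) : Prop :=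
  forall i j, connect (adjacent Q) i j.

(* [e] enumerates the vertices along the path; the sum counts the arrows between
   [e i] and [e j] in either direction. *)
Definition path_orientation (V : finType) (P : quiver V) : Prop :=
  exists2 e : 'I_#|V| -> V, bijective e &
    forall i j : 'I_#|V|,
      P (e i) (e j) + P (e j) (e i)
      = nat_of_bool ((i.+1 == j :> nat) || (j.+1 == i :> nat)).

Definition mutation_type_A (V : finType) (Q : quiver V) : Prop :=
  exists P : quiver V, path_orientation P /\
    exists s : seq V, forall i j, mutates pred0 P s i j = Q i j.

Section Framed.
Variables (V : finType) (Q : quiver V).

(* [inl i] is the mutable vertex [i] and [inr i] its frozen copy [i']. *)
Definition framed_arrows (u v : V + V) : nat :=
  match u, v with
  | inl i, inl j => Q i j
  | inl i, inr j => i == j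
  | inr _, _ => 0
  end.

Lemma framed_no_loop u : framed_arrows u u = 0.
Proof. by case: u => i //=; apply: no_loop. Qed.

Lemma framed_no_2cycle u v : framed_arrows u v = 0 \/ framed_arrows v u = 0.
Proof.
by case: u v => i [] j /=; [apply: no_2cycle | right | left | left].
Qed.

Definition framed : quiver (V + V)%type :=
  Quiver framed_no_loop framed_no_2cycle.

Definition is_frozen (u : V + V) : bool := if u is inr _ then true else false.

Definition framed_mutates (s : seq V) : quiver (V + V)%type :=
  mutates is_frozen framed (map inl s).

Definition green (R : quiver (V + V)%type) (i : V) : Prop :=
  forall j, R (inr j) (inl i) = 0.

Definition red (R : quiver (V + V)%type) (i : V) : Prop :=
  forall j, R (inl i) (inr j) = 0.

Definition maximal_green_sequence (s : seq V) : Prop :=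
  (forall s1 i s2, s = s1 ++ i :: s2 -> green (framed_mutates s1) i) /\
  (forall i, red (framed_mutates s) i).

Definition minimal_mgs_length (l : nat) : Prop :=
  (exists2 s, maximal_green_sequence s & size s = l) /\
  (forall s, maximal_green_sequence s -> l <= size s).

End Framed.

(* Main.v *)
(** Gluing: if a maximal green sequence of [Q^i] has the form [s1, x_i, s2] with
    [x_i] absent from [s1, s2] and a source of [Q^i] when it is mutated, then the
    rest of [Q^i] behaves during [mu_Q] like further frozen vertices attached in
    parallel with [x_i'], so [s1, mu_Q, s2] is a maximal green sequence of the glued
    quiver, of length [l(mu_Q) + (length for Q^i) - 1].

    A quiver of mutation type A is the quiver of a triangulated polygon, encoded by
    the dual tree centered at one of its edges; mutation is a flip at the center.
    Cutting the tree at its triangles and gluing sequences for the point, the arrow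
    and the oriented 3-cycle gives, for any vertex [x], a maximal green sequence as
    above of length [n + t], where [t] is the number of 3-cycles.

    No maximal green sequence is shorter.  The c-vectors are the shear coordinates,
    with respect to the current triangulation, of the original arcs with both ends
    turned slightly.  A green flip changes the topology of a quadruple of boundary
    edges in one direction only, and at the end all arcs have been turned; hence
    every [v] occurs as the support of a c-vector.  By the pentagon relation, for an
    arrow [a -> b] along which [b] comes before [a], the support [{a, b}] occurs as
    well, and this happens on at least one arrow of each oriented 3-cycle. *)
Require Import Defs.
From mathcomp Require Import all_boot all_order all_algebra zify ring.
Set Implicit Arguments.
Unset Strict Implicit.
Unset Printing Implicit Defensive.
Import Order.TTheory GRing.Theory Num.Theory.

(** * Mutation of skew-symmetric integer matrices *)

(** A shortest sequence of [Q^i] may mutate [x i] more than once: the oriented 3-cycle needs four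
    mutations, so some vertex is always mutated twice. The special form therefore cannot be read off
    an arbitrary shortest sequence. Instead the exact minimum [n + t] is determined, attained by
    special sequences for every choice of [x] and matched by the lower bound. The polygon carries no
    geometry. Boundary edges are numbers, a turned arc is the pair of boundary edges at its ends,
    and its crossing with a quadrilateral is read off from the sides that contain these two numbers.
    Planarity survives only as the cyclic order of the numbers, so crossing arguments become finite
    checks on sides numbered 0 to 3. *)

Section IntMutation.
Local Open Scope ring_scope.

Definition pos (x : int) : int := if 0 <= x then x else 0.

Lemma pos_id x : 0 <= x -> pos x = x. Proof. by rewrite /pos => ->. Qed.

Lemma pos_eq0 x : x <= 0 -> pos x = 0.
Proof. by rewrite /pos => x_le0; case: ifP => // x_ge0; lia. Qed.

Lemma posM m x : 0 <= m -> pos (m * x) = m * pos x.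
Proof.
move=> m_ge0; have [x_ge0|x_lt0] := lerP 0 x.
  by rewrite !pos_id // mulr_ge0.
have x_le0 := ltW x_lt0.
by rewrite !pos_eq0 ?mulr0 // mulr_ge0_le0.
Qed.

Lemma posM_posN (m1 m2 x : int) :
  0 <= m1 -> 0 <= m2 -> pos (m1 * x) * pos (- (m2 * x)) = 0.
Proof.
move=> m1_ge0 m2_ge0; rewrite -mulrN !posM //.
have [x_ge0|x_lt0] := lerP 0 x.
  by rewrite [pos (- x)]pos_eq0 ?mulr0 //; lia.
by rewrite [pos x]pos_eq0 ?mulr0 ?mul0r //; lia.
Qed.

(** With signed entries the removal of 2-cycles is a subtraction instead of a truncation, and [pos]
    recovers the numbers of arrows. *)
Definition mu (U : eqType) (k : U) (M : U -> U -> int) u v : int :=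
  if (u == k) || (v == k) then - M u v
  else M u v + pos (M u k) * pos (M k v) - pos (M v k) * pos (M k u).

Definition skew_sym (U : Type) (M : U -> U -> int) := forall u v, M u v = - M v u.

Lemma skew_mu (U : eqType) (k : U) M : skew_sym M -> skew_sym (mu k M).
Proof.
move=> skM u v; rewrite /mu orbC; case: ifP => _; first by rewrite (skM u).
by rewrite (skM u v); ring.
Qed.

Definition qmx (V : finType) (Q : quiver V) u v : int := (Q u v)%:Z - (Q v u)%:Z.

Lemma skew_qmx (V : finType) (Q : quiver V) : skew_sym (qmx Q).
Proof. by move=> u v; rewrite /qmx; lia. Qed.

Lemma pos_qmx (V : finType) (Q : quiver V) u v : pos (qmx Q u v) = (Q u v)%:Z.
Proof.
rewrite /qmx; case: (no_2cycle Q u v) => ->.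
  by rewrite pos_eq0; lia.
by rewrite pos_id; lia.
Qed.

Lemma qmx_mutate (V : finType) (fr : pred V) (Q : quiver V) k u v :
  ~~ (fr u && fr v) -> qmx (mutate fr Q k) u v = mu k (qmx Q) u v.
Proof.
move=> nfr; rewrite /qmx /= /mutate_arrows /reduce [fr v && _]andbC (negPf nfr).
rewrite /mu !pos_qmx /reverse_at /add_paths [(v == k) || _]orbC.
by case: ifP => [/orP[]/eqP->|_]; rewrite ?no_loop /qmx; lia.
Qed.

Definition framed_mx (V : eqType) (b : V -> V -> int) (u v : V + V) : int :=
  match u, v with
  | inl i, inl j => b i j
  | inl i, inr j => (i == j)%:Z
  | inr i, inl j => - (i == j)%:Z
  | inr _, inr _ => 0
  end.

Definition mus (V : eqType) (M : V + V -> V + V -> int) (s : seq V) :=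
  foldl (fun M k => mu (inl k) M) M s.

Definition run (V : eqType) (b : V -> V -> int) (s : seq V) := mus (framed_mx b) s.

Lemma skew_framed_mx (V : eqType) (b : V -> V -> int) : skew_sym b -> skew_sym (framed_mx b).
Proof. by move=> skb [i|i] [j|j] /=; rewrite ?opprK ?oppr0 // eq_sym. Qed.

Lemma skew_mus (V : eqType) M (s : seq V) : skew_sym M -> skew_sym (mus M s).
Proof. by elim: s M => //= k s IH M skM; apply/IH/skew_mu. Qed.

Lemma skew_run (V : eqType) (b : V -> V -> int) s : skew_sym b -> skew_sym (run b s).
Proof. by move=> skb; apply/skew_mus/skew_framed_mx. Qed.

Lemma mus_cat (V : eqType) M (s t : seq V) : mus M (s ++ t) = mus (mus M s) t.
Proof. exact: foldl_cat. Qed.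

Lemma run_cat (V : eqType) (b : V -> V -> int) (s t : seq V) :
  run b (s ++ t) = mus (run b s) t.
Proof. exact: mus_cat. Qed.

Lemma run_rcons (V : eqType) (b : V -> V -> int) (s : seq V) k :
  run b (rcons s k) = mu (inl k) (run b s).
Proof. by rewrite /run /mus foldl_rcons. Qed.

Definition frz (T : Type) (u : T + T) : bool := if u is inr _ then true else false.

(** Entries between frozen vertices do differ, since the quiver mutation deletes those arrows. They
    never influence the others: mutation at [inl k] changes an entry by products of entries in the
    row or column of [inl k]. *)
Lemma qmx_framed_mutates (V : finType) (Q : quiver V) s u v :
  ~~ (frz u && frz v) ->
  qmx (framed_mutates Q s) u v = run (qmx Q) s u v.
Proof.
elim/last_ind: s u v => [|s k IH] u v nfr.
  move: u v nfr => [i|i] [j|j] //= _; rewrite /qmx /= ?subr0 //.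
  by rewrite sub0r eq_sym.
rewrite /framed_mutates map_rcons /mutates foldl_rcons run_rcons.
rewrite qmx_mutate // /mu.
by rewrite !IH //= ?andbF.
Qed.

Definition sum_map (W V : Type) (f : W -> V) (u : W + W) : V + V :=
  match u with inl i => inl (f i) | inr i => inr (f i) end.

Lemma run_map (W V : eqType) (f : W -> V) b b' (s : seq W) u v :
  injective f -> (forall i j, b i j = b' (f i) (f j)) ->
  ~~ (frz u && frz v) ->
  run b s u v = run b' (map f s) (sum_map f u) (sum_map f v).
Proof.
move=> injf eqb; elim/last_ind: s u v => [|s k IH] u v nfr.
  by move: u v nfr => [i|i] [j|j] //= _; rewrite /run /= ?eqb ?(inj_eq injf).
rewrite map_rcons !run_rcons /mu.
have eqk w : (sum_map f w == inl (f k)) = (w == inl k).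
  by case: w => i //=; rewrite !/(inl _ == _) /= (inj_eq injf).
by rewrite !eqk !IH //= ?andbF.
Qed.

End IntMutation.

(** * Gluing maximal green sequences *)

Section Mgs.
Local Open Scope ring_scope.
Variable V : eqType.
Implicit Types (M : V + V -> V + V -> int) (S : pred V) (b : V -> V -> int).

Fixpoint greens S M (s : seq V) : Prop :=
  if s is k :: s' then
    (forall f, S f -> 0 <= M (inl k) (inr f)) /\ greens S (mu (inl k) M) s'
  else True.

Lemma greens_cat S M s t :
  greens S M (s ++ t) <-> greens S M s /\ greens S (mus M s) t.
Proof.
elim: s M => [|k s IH] M /=; first by split=> [|[]].
by rewrite IH; split=> [[? []]|[[]]].
Qed.

(** These are the maximal green sequences of the full subquiver on [S], computed in the framing of
    all of [V]: mutation at a vertex of [S] updates the entries indexed by [S] from such entries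
    alone. Gluing thus needs no subtypes. *)
Definition mgs b S s :=
  [/\ all S s, greens S (framed_mx b) s &
      forall i f, S i -> S f -> run b s (inl i) (inr f) <= 0].

(** The source clause and greenness together make the whole row of [w] over [S] nonnegative when [w]
    is mutated, its only time. *)
Definition mgs_source b S w s1 s2 :=
  [/\ mgs b S (s1 ++ w :: s2), w \notin s1, w \notin s2 &
      forall y, S y -> 0 <= run b s1 (inl w) (inl y)].

Lemma eq_mgs b S S' s : S =1 S' -> mgs b S s -> mgs b S' s.
Proof.
move=> eqS [sS gs final]; split.
- by rewrite -(eq_all eqS).
- elim: s (framed_mx b) gs {sS final} => //= k s IH M [gk gs]; split; last exact: IH.
  by move=> f; rewrite -eqS; apply: gk.
- by move=> i f; rewrite -!eqS; apply: final.
Qed.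

Lemma eq_mgs_source b S S' w s1 s2 :
  S =1 S' -> mgs_source b S w s1 s2 -> mgs_source b S' w s1 s2.
Proof.
move=> eqS [m w1 w2 src]; split=> //; first exact: eq_mgs eqS m.
by move=> y; rewrite -eqS; apply: src.
Qed.

End Mgs.

Section Glue.
Local Open Scope ring_scope.
Variables (V : eqType) (S0 S1 : pred V) (w : V).
Hypotheses (S0w : S0 w) (S1w : S1 w).
Hypothesis S01 : forall i, S0 i -> S1 i -> i = w.
Implicit Types (M : V + V -> V + V -> int).

(** The mutable [w] belongs to the core and its frozen copy to the side, so that the core sees
    everything on the side, this copy included, through the multiplicities [m]. *)
Let core (u : V + V) := match u with inl i => S0 i | inr i => S0 i && (i != w) end.
Let side (u : V + V) := match u with inl i => S1 i && (i != w) | inr i => S1 i end.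

(* In a state [M] of the glued quiver, a vertex [i] of the first part sees the
   second part as [w] does in its own state [M1], with multiplicity [m i]. *)
Record glued M M0 M1 (m : V -> int) : Prop := Glued {
  gl_core : forall i u, S0 i -> core u -> M (inl i) u = M0 (inl i) u;
  gl_mult : forall i u, S0 i -> side u -> M (inl i) u = m i * M1 (inl w) u;
  gl_side : forall y u, S1 y -> y != w -> side u -> M (inl y) u = M1 (inl y) u;
  gl_zero : forall y u, S1 y -> y != w -> S0 u -> u != w -> M (inl y) (inr u) = 0 }.

(** All core vertices see [k] through nonnegative multiples of the same number, so no path through
    [k] joins two of them, and [pos] commutes with the multiplicities. *)
Lemma glued_side_mu M M0 M1 m k :
  skew_sym M -> skew_sym M1 -> glued M M0 M1 m -> (forall i, S0 i -> 0 <= m i) ->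
  S1 k -> k != w -> glued (mu (inl k) M) M0 (mu (inl k) M1) m.
Proof.
move=> skM skM1 [gc gm gs gz] m_ge0 S1k kw.
have kS0 i : S0 i -> (inl i == inl k :> V + V) = false.
  move=> S0i; apply/negbTE; apply: contraNN kw => /eqP[ik].
  by apply/eqP/S01; rewrite // -ik.
have sk : side (inl k) by rewrite /= S1k.
have wk : (inl w == inl k :> V + V) = false by apply: kS0.
split.
- move=> i u S0i cu; rewrite /mu (kS0 i S0i) /=.
  have -> : (u == inl k) = false by case: u cu => // j /kS0.
  rewrite (gc i u) // (gm i (inl k)) //; case: u cu => [j S0j|j /andP[S0j jw]].
    rewrite (skM (inl k) (inl j)) (skM (inl k) (inl i)) !gm //.
    rewrite posM_posN ?m_ge0 // posM_posN ?m_ge0 //; ring.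
  by rewrite gz // (skM (inr j)) gz // oppr0 /pos lexx; ring.
- move=> i u S0i su; rewrite /mu (kS0 i S0i) wk /= (gm i u) //.
  case: ifP => [_|uk]; first by ring.
  have eku : M (inl k) u = M1 (inl k) u by rewrite gs.
  have euk : M u (inl k) = M1 u (inl k) by rewrite skM eku -skM1.
  rewrite eku euk gm // (skM (inl k)) gm // (skM1 (inl k) (inl w)).
  by rewrite -[- (m i * M1 _ _)]mulrN !posM ?m_ge0 //; ring.
- move=> y u S1y yw su; rewrite /mu; case: ifP => _; first by rewrite gs.
  rewrite (skM u) (skM (inl k) (inl y)) (skM1 u) (skM1 (inl k) (inl y)).
  have sy : side (inl y) by rewrite /= S1y.
  by rewrite !gs.
- move=> y u S1y yw S0u uw; rewrite /mu gz // oppr0; case: ifP => // _.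
  by rewrite (skM (inr u)) !gz // oppr0 /pos lexx; ring.
Qed.

Lemma glued_core_mu M M0 M1 k :
  skew_sym M -> skew_sym M0 -> skew_sym M1 -> glued M M0 M1 (fun i => M0 (inl i) (inr w)) ->
  S0 k -> (forall f, S0 f -> 0 <= M0 (inl k) (inr f)) ->
  (forall u, side u -> 0 <= M1 (inl w) u) ->
  glued (mu (inl k) M) (mu (inl k) M0) M1 (fun i => mu (inl k) M0 (inl i) (inr w)).
Proof.
move=> skM skM0 skM1 [gc gm gs gz] S0k gk src.
have kS1 y : S1 y -> y != w -> (inl y == inl k :> V + V) = false.
  move=> S1y yw; apply/negbTE; apply: contraNN yw => /eqP[yk].
  by apply/eqP/S01; rewrite // yk.
have ks u : side u -> (u == inl k) = false.
  by case: u => // y /andP[S1y yw]; apply: kS1.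
have skge u : side u -> 0 <= M (inl k) u.
  by move=> su; rewrite gm // mulr_ge0 ?src ?gk.
split.
- by move=> i u S0i cu; rewrite /mu (skM u (inl k)) (skM0 u (inl k)) !gc.
- move=> i u S0i su; rewrite /mu (ks u su) !orbF.
  case: ifP => [_|ik]; first by rewrite gm //; ring.
  rewrite (gm i u) // (gc i (inl k)) // (gm k u) // (skM u) (gm k u) //.
  rewrite [pos (- _)]pos_eq0 ?oppr_le0 ?mulr_ge0 ?src ?gk // posM ?gk //.
  rewrite (pos_id (src _ su)) (skM0 (inr w)) [pos (- _)]pos_eq0 ?oppr_le0 ?gk //.
  by rewrite [pos (M0 (inl k) _)]pos_id ?gk //; ring.
- move=> y u S1y yw su; have sy : side (inl y) by rewrite /= S1y.
  rewrite /mu !ks //= gs // (skM (inl y)) (skM u).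
  rewrite ![pos (- M (inl k) _)]pos_eq0 ?oppr_le0 ?skge //; ring.
- move=> y u S1y yw S0u uw; have sy : side (inl y) by rewrite /= S1y.
  rewrite /mu ks //= gz // (skM (inl y)) (skM (inr u)).
  have ku : 0 <= M (inl k) (inr u) by rewrite gc ?gk //= S0u.
  rewrite [pos (- M _ (inl y))]pos_eq0 ?oppr_le0 ?skge //.
  by rewrite [pos (- M _ (inr u))]pos_eq0 ?oppr_le0 //; ring.
Qed.

Let Su : pred V := fun i => S0 i || S1 i.

Lemma glued_side_mus s M M0 M1 m :
  skew_sym M -> skew_sym M1 -> glued M M0 M1 m -> (forall i, S0 i -> 0 <= m i) ->
  all S1 s -> w \notin s -> greens S1 M1 s ->
  glued (mus M s) M0 (mus M1 s) m /\ greens Su M s.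
Proof.
move=> skM skM1 gl m_ge0; elim: s M M1 skM skM1 gl => //= k s IH M M1 skM skM1 gl.
case/andP=> S1k S1s; rewrite inE negb_or eq_sym => /andP[kw ws] [gk gs].
have [] // := IH _ _ (skew_mu (inl k) skM) (skew_mu (inl k) skM1).
  exact: glued_side_mu.
move=> gl' gs'; split=> //; split=> // f Sf.
have [S1f|S1f] := boolP (S1 f); first by rewrite (gl_side gl) ?gk.
have fw : f != w by apply: contraNneq S1f => ->.
by move: Sf; rewrite /Su /= (negbTE S1f) orbF => S0f; rewrite (gl_zero gl).
Qed.

Lemma glued_core_mus s M M0 M1 :
  skew_sym M -> skew_sym M0 -> skew_sym M1 -> glued M M0 M1 (fun i => M0 (inl i) (inr w)) ->
  (forall u, side u -> 0 <= M1 (inl w) u) ->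
  all S0 s -> greens S0 M0 s ->
  glued (mus M s) (mus M0 s) M1 (fun i => mus M0 s (inl i) (inr w)) /\
  greens Su M s.
Proof.
move=> skM skM0 skM1 gl src; elim: s M M0 skM skM0 gl => //= k s IH M M0 skM skM0 gl.
case/andP=> S0k S0s [gk gs].
have [] // := IH _ _ (skew_mu (inl k) skM) (skew_mu (inl k) skM0).
  exact: glued_core_mu.
move=> gl' gs'; split=> //; split=> // f Sf.
have [S1f|S1f] := boolP (S1 f); first by rewrite (gl_mult gl) // mulr_ge0 ?gk ?src.
have fw : f != w by apply: contraNneq S1f => ->.
move: Sf; rewrite /Su /= (negbTE S1f) orbF => S0f.
by rewrite (gl_core gl) ?gk //= S0f.
Qed.

Variable b : V -> V -> int.
Hypothesis skb : skew_sym b.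
Hypothesis b0 : forall i j, S0 i -> i != w -> S1 j -> j != w -> b i j = 0.

Lemma glued_framed :
  glued (framed_mx b) (framed_mx b) (framed_mx b) (fun i => framed_mx b (inl i) (inr w)).
Proof.
split=> //=.
  move=> i u S0i su; have [->|iw] := eqVneq i w; first by rewrite mul1r.
  rewrite mul0r; case: u su => [j /andP[S1j jw]|j S1j]; first by rewrite b0.
  by case: eqVneq => // ij; case/eqP: iw; apply: S01; rewrite // ij.
move=> y u S1y yw S0u uw; case: eqVneq => // yu.
by case/eqP: yw; apply: S01; rewrite // yu.
Qed.

Variables s1 s2 : seq V.
Hypothesis src1 : mgs_source b S1 w s1 s2.

Lemma glued_before_core s :
  all S0 s -> greens S0 (framed_mx b) s ->
  [/\ greens Su (framed_mx b) (s1 ++ s), forall u, side u -> 0 <= run b s1 (inl w) u &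
      glued (run b (s1 ++ s)) (run b s) (run b s1) (fun i => run b s (inl i) (inr w))].
Proof.
move=> S0s gs; have [[]] := src1.
rewrite all_cat /= => /and3P[S1s1 _ S1s2] /greens_cat[gs1 [gw gs2]] _ ws1 ws2 sw.
have skf := skew_framed_mx skb.
have [|gl1 gsu1] := glued_side_mus skf skf glued_framed _ S1s1 ws1 gs1; first by [].
have side_ge0 u : side u -> 0 <= run b s1 (inl w) u.
  by case: u => [y /andP[S1y _]|f S1f]; [apply: sw | apply: gw].
have [|gl2 gsu2] := glued_core_mus (skew_mus s1 skf) skf (skew_mus s1 skf) gl1 _ S0s gs.
  by [].
by split=> //; [apply/greens_cat | rewrite run_cat].
Qed.

Lemma mgs_glue s : mgs b S0 s -> mgs b Su (s1 ++ s ++ s2).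
Proof.
move=> [S0s gs fin]; have [gsu side_ge0 gl] := glued_before_core S0s gs.
have [[]] := src1.
rewrite all_cat /= => /and3P[S1s1 _ S1s2] /greens_cat[gs1 [gw gs2]] fin1 ws1 ws2 sw.
pose M1 := mu (inl w) (run b s1).
have skM := skew_run (s1 ++ s) skb.
have skM1 : skew_sym M1 by apply/skew_mu/skew_run.
(* Now all multiplicities are nonpositive. Mutating the side at [w] negates the row of [w], which
   allows negating the multiplicities; the rest of the side is unchanged because [w] is a source. *)
have gl' : glued (run b (s1 ++ s)) (run b s) M1 (fun i => - run b s (inl i) (inr w)).
  have sideN u : side u -> (u == inl w) = false.
    by case: u => // y /andP[_ yw]; apply/negbTE; apply: contraNN yw => /eqP[->].
  case: gl => gc gm gd gz; split=> //.
    by move=> i u S0i su; rewrite gm // /M1 /mu eqxx /=; ring.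
  move=> y u S1y yw su; have sy : side (inl y) by rewrite /= S1y.
  rewrite gd // /M1 /mu !sideN //= (skew_run s1 skb _ (inl w)).
  rewrite (skew_run s1 skb u (inl w)).
  by rewrite ![pos (- _)]pos_eq0 ?oppr_le0 ?side_ge0 //; ring.
have m_ge0 i : S0 i -> 0 <= - run b s (inl i) (inr w).
  by move=> S0i; rewrite oppr_ge0 fin.
have [gl3 gsu3] := glued_side_mus skM skM1 gl' m_ge0 S1s2 ws2 gs2.
split.
- rewrite !all_cat; apply/and3P; split.
  + by apply: sub_all S1s1 => i S1i; rewrite /Su S1i orbT.
  + by apply: sub_all S0s => i S0i; rewrite /Su S0i.
  + by apply: sub_all S1s2 => i S1i; rewrite /Su S1i orbT.
- by rewrite catA; apply/greens_cat.
move=> i f Si Sf; rewrite catA run_cat.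
have M1E : mus M1 s2 = run b (s1 ++ w :: s2) by rewrite run_cat.
rewrite M1E in gl3; have [S0i|S0i] := boolP (S0 i).
  have [S1f|S1f] := boolP (S1 f).
    by rewrite (gl_mult gl3) // mulr_ge0_le0 ?m_ge0 ?fin1.
  have fw : f != w by apply: contraNneq S1f => ->.
  move: Sf; rewrite /Su /= (negbTE S1f) orbF => S0f.
  by rewrite (gl_core gl3) ?fin //= S0f.
move: Si; rewrite /Su /= (negbTE S0i) => /= S1i.
have iw : i != w by apply: contraNneq S0i => ->.
have [S1f|S1f] := boolP (S1 f); first by rewrite (gl_side gl3) ?fin1.
have fw : f != w by apply: contraNneq S1f => ->.
move: Sf; rewrite /Su /= (negbTE S1f) orbF => S0f.
by rewrite (gl_zero gl3).
Qed.

(** This lets gluing be iterated. The core vertex [x] remains a source: its entries on the side are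
    its multiplicity, nonnegative as [x] is green, times the nonnegative row of [w]. *)
Lemma mgs_source_glue x t1 t2 :
  mgs_source b S0 x t1 t2 -> mgs_source b Su x (s1 ++ t1) (t2 ++ s2).
Proof.
move=> [mx xt1 xt2 src].
have mx' : mgs b Su ((s1 ++ t1) ++ x :: (t2 ++ s2)).
  by have := mgs_glue mx; rewrite -!catA.
have [] := mx; rewrite all_cat /= => /and3P[S0t1 S0x _] /greens_cat[gt1 [gx _]] _.
have [gsu side_ge0 gl] := glued_before_core S0t1 gt1.
have [[]] := src1.
rewrite all_cat /= => /and3P[S1s1 _ S1s2] _ _ ws1 ws2 _.
have xS1 t : all S1 t -> w \notin t -> x \notin t.
  move=> S1t; apply: contraNN => xt; rewrite -(S01 S0x) //.
  exact: (allP S1t).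
split; rewrite ?mem_cat ?negb_or ?xt1 ?xt2 ?xS1 //.
move=> y Sy; have [S0y|S0y] := boolP (S0 y).
  by rewrite (gl_core gl) // src.
move: Sy; rewrite /Su /= (negbTE S0y) => /= S1y.
have yw : y != w by apply: contraNneq S0y => ->.
have sy : side (inl y) by rewrite /= S1y.
by rewrite (gl_mult gl) // mulr_ge0 ?side_ge0 ?gx.
Qed.

End Glue.

(** * Triangulated polygons *)

(* A triangulation of a polygon seen from one of its edges: inner edges carry a
   vertex of the quiver, boundary edges a number.  The triangle below the edge [x]
   of [Nd x l r] has the roots of [l] and [r] as its other sides, and carries the
   arrows [x -> root l -> root r -> x] between its inner sides. *)
Inductive tree (V : Type) := Lf of nat | Nd of V & tree V & tree V.
Arguments Lf {V}.

(* The whole polygon seen from the inner edge [ck]: around it lies the quadrilateral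
   with sides, in cyclic order, the roots of [cl1], [cr1], [cl2], [cr2]. *)
Record center (V : Type) :=
  Ctr { ck : V; cl1 : tree V; cr1 : tree V; cl2 : tree V; cr2 : tree V }.

Section Trees.
Variable V : eqType.
Implicit Types (t l r : tree V) (c : center V).

Fixpoint labels t : seq V :=
  if t is Nd y l r then y :: labels l ++ labels r else [::].

Fixpoint leaves t : seq nat :=
  match t with Lf p => [:: p] | Nd _ l r => leaves l ++ leaves r end.

Definition clabels c :=
  ck c :: labels (cl1 c) ++ labels (cr1 c) ++ labels (cl2 c) ++ labels (cr2 c).

Definition word c :=
  leaves (cl1 c) ++ leaves (cr1 c) ++ leaves (cl2 c) ++ leaves (cr2 c).

Definition wf c := uniq (clabels c) && uniq (word c).

(** Different views of one triangulation: [rc_swap] looks at the same edge from its other side, the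
    other two rules step across a triangle to a neighbouring inner edge. The cyclic order of the
    leaves is kept. *)
Inductive recenter : center V -> center V -> Prop :=
| rc_refl c : recenter c c
| rc_swap k l1 r1 l2 r2 c :
    recenter (Ctr k l2 r2 l1 r1) c -> recenter (Ctr k l1 r1 l2 r2) c
| rc_left k y l r r1 l2 r2 c :
    recenter (Ctr y l r r1 (Nd k l2 r2)) c ->
    recenter (Ctr k (Nd y l r) r1 l2 r2) c
| rc_right k l1 y l r l2 r2 c :
    recenter (Ctr y l r (Nd k l2 r2) l1) c ->
    recenter (Ctr k l1 (Nd y l r) l2 r2) c.

Lemma recenter_trans c1 c2 c3 :
  recenter c1 c2 -> recenter c2 c3 -> recenter c1 c3.
Proof. by elim=> // *; [apply: rc_swap | apply: rc_left | apply: rc_right]; auto. Qed.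

Lemma recenter_perm c c' : recenter c c' ->
  perm_eq (clabels c) (clabels c') /\ perm_eq (word c) (word c').
Proof.
elim=> {c c'} //.
- move=> k l1 r1 l2 r2 c _ [IH1 IH2].
  split; [apply: perm_trans IH1|apply: perm_trans IH2]; apply/permP => a;
  by rewrite /clabels /word /= ?count_cat /= ?count_cat; lia.
- move=> k y l r r1 l2 r2 c _ [IH1 IH2].
  split; [apply: perm_trans IH1|apply: perm_trans IH2]; apply/permP => a;
  by rewrite /clabels /word /= ?count_cat /= ?count_cat /= ?count_cat; lia.
- move=> k l1 y l r l2 r2 c _ [IH1 IH2].
  split; [apply: perm_trans IH1|apply: perm_trans IH2]; apply/permP => a;
  by rewrite /clabels /word /= ?count_cat /= ?count_cat /= ?count_cat; lia.
Qed.

Lemma recenter_wf c c' : recenter c c' -> wf c -> wf c'.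
Proof.
by case/recenter_perm=> p1 p2; rewrite /wf (perm_uniq p1) (perm_uniq p2).
Qed.

Lemma recenter_side t v : v \in labels t -> forall k l2 r2 l r, t = Nd k l r ->
  exists2 c, recenter (Ctr k l r l2 r2) c & ck c = v.
Proof.
elim: t => // y l IHl r IHr; rewrite /= inE mem_cat.
case/or3P=> [/eqP->|vl|vr] k l2 r2 ? ? [<- <- <-].
- by exists (Ctr y l r l2 r2) => //; apply: rc_refl.
- case: l IHl vl => // y' l' r' IHl vl.
  by have [c rc cv] := IHl vl _ r (Nd y l2 r2) _ _ erefl; exists c => //; apply: rc_left.
- case: r IHr vr => // y' l' r' IHr vr.
  by have [c rc cv] := IHr vr _ (Nd y l2 r2) l _ _ erefl; exists c => //; apply: rc_right.
Qed.

Lemma recenter_at c v : v \in clabels c -> exists2 c', recenter c c' & ck c' = v.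
Proof.
case: c => k l1 r1 l2 r2; rewrite /clabels /= inE !mem_cat => vc.
have /orP[v1|v2] : (v \in labels (Nd k l1 r1)) || (v \in labels (Nd k l2 r2)).
  by case/or3P: vc => [h|h|/or3P[]h]; rewrite /= !inE !mem_cat ?h ?orbT.
- exact: recenter_side v1 _ _ _ _ _ erefl.
- have [c rc cv] := recenter_side v2 l1 r1 erefl.
  by exists c => //; apply: rc_swap.
Qed.

(** The new diagonal inherits the label of the old one; rotating the sides by one place regroups
    them into the two new triangles. *)
Definition flip c := Ctr (ck c) (cr1 c) (cl2 c) (cr2 c) (cl1 c).

Lemma flip_perm c : perm_eq (clabels c) (clabels (flip c)) /\
  perm_eq (word c) (word (flip c)).
Proof.
by split; apply/permP => a; rewrite /clabels /word /= ?count_cat /= ?count_cat; lia.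
Qed.

Lemma flip_wf c : wf c -> wf (flip c).
Proof.
by case: (flip_perm c) => p1 p2; rewrite /wf (perm_uniq p1) (perm_uniq p2).
Qed.

Local Open Scope ring_scope.

Definition delta (y i : V) : int := if i == y then 1 else 0.

Definition rt t (i : V) : int := if t is Nd y _ _ then delta y i else 0.

Definition edge (f g : V -> int) i j : int := f i * g j - f j * g i.

Fixpoint tree_mx t i j : int :=
  if t is Nd y l r then
    edge (delta y) (rt l) i j + edge (rt l) (rt r) i j +
    edge (rt r) (delta y) i j + tree_mx l i j + tree_mx r i j
  else 0.

Definition ctr_mx c i j : int :=
  tree_mx (Nd (ck c) (cl1 c) (cr1 c)) i j + tree_mx (Nd (ck c) (cl2 c) (cr2 c)) i j.

Lemma skew_tree_mx t : skew_sym (tree_mx t).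
Proof.
by elim: t => //= y l IHl r IHr i j; rewrite /edge /= (IHl i) (IHr i); ring.
Qed.

Lemma rt_out t i : i \notin labels t -> rt t i = 0.
Proof. by case: t => //= y l r; rewrite /delta inE negb_or => /andP[/negbTE->]. Qed.

Lemma rtP t i : rt t i = 0 \/ rt t i = 1 /\ i \in labels t.
Proof.
case: t => /= [_|y l r]; first by left.
by rewrite /delta inE; case: eqP => _; [right | left].
Qed.

Lemma tree_mx_out t i j : i \notin labels t -> tree_mx t i j = 0.
Proof.
elim: t => //= y l IHl r IHr; rewrite inE mem_cat !negb_or => /and3P[/negbTE iy il ir].
by rewrite /edge /delta iy (rt_out il) (rt_out ir) IHl // IHr //; ring.
Qed.

Lemma recenter_mx c c' i j : recenter c c' -> ctr_mx c i j = ctr_mx c' i j.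
Proof.
by elim=> {c c'} // *; etransitivity; try eassumption;
  rewrite /ctr_mx /edge /=; ring.
Qed.

Lemma wf_notin c : wf c ->
  [/\ ck c \notin labels (cl1 c), ck c \notin labels (cr1 c),
      ck c \notin labels (cl2 c) & ck c \notin labels (cr2 c)].
Proof.
by case/andP=> /andP[]; rewrite !mem_cat !negb_or => /and4P[].
Qed.

Lemma ctr_mx_row c j : wf c ->
  ctr_mx c (ck c) j
  = rt (cl1 c) j + rt (cl2 c) j - (rt (cr1 c) j + rt (cr2 c) j).
Proof.
move=> /wf_notin[n1 n2 n3 n4]; rewrite /ctr_mx /= /edge /delta eqxx.
rewrite (rt_out n1) (rt_out n2) (rt_out n3) (rt_out n4).
by rewrite !tree_mx_out //; ring.
Qed.


(** The inner sides of the quadrilateral carry distinct labels, so nothing cancels in the row of the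
    center. *)
Lemma pos_ctr_mx c j : wf c ->
  pos (ctr_mx c (ck c) j) = rt (cl1 c) j + rt (cl2 c) j /\
  pos (- ctr_mx c (ck c) j) = rt (cr1 c) j + rt (cr2 c) j.
Proof.
move=> wfc; rewrite ctr_mx_row //; case/andP: wfc => /andP[_ u _].
have := count_uniq_mem j u; rewrite !count_cat.
have h t : (j \in labels t) = (0 < count_mem j (labels t))%N.
  by rewrite -has_count has_pred1.
have [e1|[e1]] := rtP (cl1 c) j; have [e2|[e2]] := rtP (cr1 c) j;
have [e3|[e3]] := rtP (cl2 c) j; have [e4|[e4]] := rtP (cr2 c) j;
rewrite ?(h (cl1 c)) ?(h (cr1 c)) ?(h (cl2 c)) ?(h (cr2 c)) e1 e2 e3 e4 => *;
  by [split | exfalso; lia].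
Qed.

Lemma ctr_mx_flip c i j : wf c -> mu (ck c) (ctr_mx c) i j = ctr_mx (flip c) i j.
Proof.
move=> wfc; have skc : skew_sym (ctr_mx c).
  by move=> u v; rewrite /ctr_mx !(skew_tree_mx _ u v); ring.
rewrite /mu; have [->|ik] := eqVneq i (ck c) => /=.
  rewrite ctr_mx_row // -[in RHS]/(ck (flip c)) ctr_mx_row ?flip_wf //=; ring.
have skf : skew_sym (ctr_mx (flip c)).
  by move=> u v; rewrite /ctr_mx !(skew_tree_mx _ u v); ring.
have [->|jk] := eqVneq j (ck c).
  rewrite skc ctr_mx_row // skf -[in RHS]/(ck (flip c)) ctr_mx_row ?flip_wf //=; ring.
have [pi ni] := pos_ctr_mx i wfc; have [pj nj] := pos_ctr_mx j wfc.
rewrite (skc i (ck c)) (skc j (ck c)) pi ni pj nj.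
by rewrite /ctr_mx /= /edge /delta (negbTE ik) (negbTE jk); ring.
Qed.

End Trees.

(** * Quivers of mutation type A *)

Section TypeA.
Variable W : finType.
Implicit Types (P Q : quiver W) (es : seq W) (c : center W).

(** In the triangulation of a path every node has at most one inner child, on the left for an arrow
    from [y] to the next vertex and on the right for the reverse arrow. At the last vertex the
    default of [head] asks for a loop, so the second branch is taken and gives two leaves. *)
Fixpoint chain P es p : tree W :=
  if es is y :: ys then
    if 0 < P y (head y ys) then Nd y (chain P ys p) (Lf (p + size ys).+1)
    else Nd y (Lf p) (chain P ys p.+1)
  else Lf p.

Lemma labels_chain P es p : labels (chain P es p) = es.
Proof.
by elim: es p => //= y ys IH p; case: ifP => _ /=; rewrite IH ?cats0.
Qed.

Lemma leaves_chain P es p : leaves (chain P es p) = iota p (size es).+1.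
Proof.
elim: es p => // y ys IH p; rewrite [chain _ _ _]/=; case: ifP => _.
  by rewrite [leaves _]/= IH -[[:: _]]/(iota _ 1) -addnS -iotaD addn1.
by rewrite [leaves _]/= IH.
Qed.

Fixpoint path_like P es : Prop :=
  if es is y :: ys then
    [/\ y \notin ys, forall j, j \in ys -> P y j + P j y = (j == head y ys) &
        path_like P ys]
  else True.

Lemma path_like_orientation P : path_orientation P ->
  exists es, [/\ uniq es, forall v, v \in es & path_like P es].
Proof.
case=> e bije eP; have inje := bij_inj bije.
pose es := map e (enum 'I_#|W|); exists es; split.
- by rewrite map_inj_uniq ?enum_uniq.
- by move=> v; case: bije => g _ ge; rewrite -[v]ge map_f ?mem_enum.
have idx s a : map val (s : seq 'I_#|W|) = iota a (size s) -> path_like P (map e s).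
  elim: s a => //= i s IH a [ia sa]; split; last exact: IH sa.
  - rewrite mem_map //; apply/negP => is'; have : val i \in map val s by apply: map_f.
    by rewrite sa mem_iota /= ia ltnn.
  - move=> j /mapP[j' js ->]; rewrite eP.
    have : val j' \in map val s by apply: map_f.
    rewrite sa mem_iota => /andP[aj _].
    case: s js sa {IH} => //= i' s js [i'a sa]; rewrite (inj_eq inje).
    by rewrite -val_eqE /= i'a -ia; congr nat_of_bool; rewrite -ia /= in aj; lia.
by apply: (idx _ 0); rewrite val_enum_ord size_enum_ord.
Qed.

Local Open Scope ring_scope.

Lemma rt_chain P es p i :
  rt (chain P es p) i = if es is y :: _ then delta y i else 0.
Proof. by case: es => //= y ys; case: ifP. Qed.

Lemma tree_mx_chain P es p i j : path_like P es -> i \in es -> j \in es ->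
  tree_mx (chain P es p) i j = qmx P i j.
Proof.
elim: es p i j => //= y ys IH p i j [yys Py Pys].
suff row q k : k \in ys ->
    tree_mx (if (0 < P y (head y ys))%N then Nd y (chain P ys p) (Lf q)
             else Nd y (Lf p) (chain P ys p.+1)) y k = qmx P y k.
  rewrite !inE; case/orP=> [/eqP->|iys] /orP[/eqP->|jys].
  - rewrite /qmx subrr; set t := (t in tree_mx t).
    by have := skew_tree_mx t y y; move: (tree_mx _ _ _) => z; lia.
  - exact: row.
  - by rewrite skew_tree_mx row // skew_qmx opprK.
  - have ny k : k \in ys -> (k == y) = false.
      by move=> kys; apply: contraNF yys => /eqP<-.
    by case: ifP => _ /=; rewrite /edge /delta !ny // IH //; ring.
move=> kys; have ky : (k == y) = false by apply: contraNF yys => /eqP<-.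
have out q' : tree_mx (chain P ys q') y k = 0 by rewrite tree_mx_out ?labels_chain.
have Pk := Py k kys; case: ifP => Pz /=; rewrite out /edge !rt_chain /delta eqxx ky.
  case: ys yys Py kys Pk Pz {IH Pys out} => // z zs yys Py kys.
  rewrite /= inE negb_or in yys; have [/negbTE-> _] := andP yys.
  by have := Py z (mem_head _ _); rewrite /qmx /= eqxx; case: (k =P z) => [->|_]; lia.
case: ys yys Py kys Pk Pz {IH Pys out} => // z zs yys Py kys.
rewrite /= inE negb_or in yys; have [/negbTE-> _] := andP yys.
by have := Py z (mem_head _ _); rewrite /qmx /= eqxx; case: (k =P z) => [->|_]; lia.
Qed.

Lemma path_orientation_center P : W -> path_orientation P ->
  exists c, [/\ wf c, forall v, v \in clabels c &
                forall i j, qmx P i j = ctr_mx c i j].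
Proof.
move=> x0 /path_like_orientation[[|y ys] [ues ces Pes]].
  by have := ces x0.
have eL := labels_chain P (y :: ys) 0.
have el := leaves_chain P (y :: ys) 0.
have em i j := tree_mx_chain 0 Pes (ces i) (ces j).
case: (chain P (y :: ys) 0%N) eL el em => [?|y' l r] // eL el em.
rewrite [labels _]/= in eL; rewrite [leaves _]/= in el.
(* The chain uses the leaves below [n]; two more close the polygon on the other side of the root
   edge. *)
pose n := (size ys).+2.
exists (Ctr y' l r (Lf n) (Lf n.+1)); split.
- have uL : uniq (y' :: labels l ++ labels r) by rewrite eL.
  rewrite /wf /clabels /word [X in uniq X && _]/= cats0 uL /= catA el.
  by rewrite -[[:: _; _]]/(iota (0 + n) 2) -iotaD iota_uniq.
- by move=> v; have := ces v; rewrite -eL /clabels /= cats0.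
- by move=> i j; rewrite -em /ctr_mx /= /edge /=; ring.
Qed.

Lemma typeA_center Q x : mutation_type_A Q ->
  exists c, [/\ wf c, ck c = x, forall v, v \in clabels c &
                forall i j, qmx Q i j = ctr_mx c i j].
Proof.
case=> P [oP [s sQ]].
have [c [wfc cc mc]] : exists c, [/\ wf c, forall v, v \in clabels c &
                forall i j, qmx (mutates pred0 P s) i j = ctr_mx c i j].
  elim/last_ind: s {sQ} => [|s k [c [wfc cc mc]]].
    exact: path_orientation_center.
  have [c' rc <-] := recenter_at (cc k); have wfc' := recenter_wf rc wfc.
  have [pl _] := recenter_perm rc; have [pf _] := flip_perm c'.
  exists (flip c'); split; first exact: flip_wf.
    by move=> v; rewrite -(perm_mem pf) -(perm_mem pl).
  move=> i j; rewrite /mutates foldl_rcons qmx_mutate // -ctr_mx_flip // /mu.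
  by rewrite !mc !(recenter_mx _ _ rc).
have [c' rc cx] := recenter_at (cc x).
exists c'; split=> //; first exact: recenter_wf wfc.
  by move=> v; have [pl _] := recenter_perm rc; rewrite -(perm_mem pl).
by move=> i j; rewrite -(recenter_mx _ _ rc) -mc /qmx !sQ.
Qed.

End TypeA.

(** * Transport of maximal green sequences along injective relabellings *)

Section MgsMap.
Local Open Scope ring_scope.
Variables (W V : eqType) (f : W -> V) (S : pred W) (S' : pred V).
Variables (b : W -> W -> int) (b' : V -> V -> int).
Hypotheses (injf : injective f) (eqb : forall i j, b i j = b' (f i) (f j)).
Hypotheses (S'f : forall i, S' (f i) = S i) (S'P : forall v, S' v -> exists i, v = f i).

Lemma greens_rcons (U : eqType) (T : pred U) d s k :
  greens T (framed_mx d) (rcons s k) <->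
  greens T (framed_mx d) s /\ forall g, T g -> 0 <= run d s (inl k) (inr g).
Proof. by rewrite -cats1 greens_cat /=; split=> [[? []]|[]]. Qed.

Lemma mgs_map s : mgs b S s <-> mgs b' S' (map f s).
Proof.
have run_f s' i g : run b s' (inl i) (inr g) = run b' (map f s') (inl (f i)) (inr (f g)).
  by rewrite (run_map s' injf eqb).
have all_f : all S' (map f s) = all S s by rewrite all_map; apply: eq_all => i /=.
split=> [] [aS gs fin]; split; rewrite ?all_f // -?all_f //.
- elim/last_ind: s gs {aS fin all_f} => // s k IH; rewrite map_rcons !greens_rcons.
  move=> [gs gk]; split=> [|g' S'g']; first exact: IH.
  by have [g eg] := S'P S'g'; rewrite eg -run_f gk // -S'f -eg.
- move=> i' g' S'i' S'g'; have [i ei] := S'P S'i'; have [g eg] := S'P S'g'.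
  by rewrite ei eg -run_f fin // -S'f -?ei -?eg.
- elim/last_ind: s gs {aS fin all_f} => // s k IH; rewrite map_rcons !greens_rcons.
  move=> [gs gk]; split=> [|g Sg]; first exact: IH.
  by rewrite run_f gk // S'f.
- by move=> i g Si Sg; rewrite run_f fin ?S'f.
Qed.

Lemma mgs_source_map x s1 s2 :
  mgs_source b S x s1 s2 -> mgs_source b' S' (f x) (map f s1) (map f s2).
Proof.
move=> [m x1 x2 src]; split; rewrite ?mem_map //.
  by move/mgs_map: m; rewrite map_cat.
move=> y' S'y'; have [y ey] := S'P S'y'; rewrite ey.
by have := run_map s1 injf eqb (isT : ~~ (frz (inl x) && frz (inl y))) => /= <-;
  apply: src; rewrite -S'f -ey.
Qed.

End MgsMap.

(** * Short maximal green sequences in type A *)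

Section SmallQuivers.
Local Open Scope ring_scope.

Definition arrow_mx (i j : bool) : int := i%:Z - j%:Z.

Lemma mgs_source_point : mgs_source (fun _ _ : unit => 0) predT tt [::] [::].
Proof. by split=> //; split=> // [|[][]] //=; split. Qed.

Lemma mgs_source_tail : mgs_source arrow_mx predT true [::] [:: false].
Proof.
split=> //; last by case; vm_compute.
split=> //; first by split=> [[]|] //; split=> [[]|]; vm_compute.
by case=> [] []; vm_compute.
Qed.

(** Mutating the tail first reverses the arrow and so turns the head into a source. *)
Lemma mgs_source_head : mgs_source arrow_mx predT false [:: true] [::].
Proof.
split=> //; last by case; vm_compute.
split=> //; first by split=> [[]|] //; split=> [[]|]; vm_compute.
by case=> [] []; vm_compute.
Qed.

Definition cycle3_mx (i j : option bool) : int :=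
  match i, j with
  | None, Some true | Some true, Some false | Some false, None => 1
  | Some true, None | Some false, Some true | None, Some false => -1
  | _, _ => 0
  end.

(** Mutating [Some false] adds an arrow that cancels [None -> Some true], which leaves [None] a
    source. The second mutation at [Some false] is the extra step that a 3-cycle costs. *)
Lemma mgs_source_cycle3 :
  mgs_source cycle3_mx predT None [:: Some false] [:: Some true; Some false].
Proof.
split=> //; last by case=> [[]|]; vm_compute.
split=> //; last by case=> [[]|] [[]|]; vm_compute.
by do 4?[split; first by case=> [[]|]; vm_compute].
Qed.

End SmallQuivers.

Definition is_node (V : Type) (t : tree V) : bool := if t is Nd _ _ _ then true else false.

Fixpoint triangles (V : Type) (t : tree V) : nat :=
  if t is Nd _ l r then (is_node l && is_node r) + triangles l + triangles r else 0.

Section TreeMgs.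
Variable V : eqType.
Implicit Types (t l r : tree V).
Local Open Scope ring_scope.

Lemma labels_uniq_node x l r : uniq (labels (Nd x l r)) ->
  [/\ x \notin labels l, x \notin labels r, uniq (labels l), uniq (labels r) &
      forall i, i \in labels l -> i \notin labels r].
Proof.
rewrite /= mem_cat negb_or cat_uniq => /and4P[/andP[xl xr] ul h ur]; split=> // i il.
by apply: contraNN h => ir; apply/hasP; exists i.
Qed.

(** A subtree is attached to the rest of the quiver at its root only. *)
Lemma tree_mx_cross x l r t i j : uniq (labels (Nd x l r)) -> t = l \/ t = r ->
  i \notin labels t -> j \in labels t -> rt t j = 0 -> tree_mx (Nd x l r) i j = 0.
Proof.
case/labels_uniq_node=> xl xr _ _ lr [] -> it jt tj.
- have jx : (j == x) = false by apply: contraNF xl => /eqP<-.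
  rewrite /= /edge /delta jx (rt_out it) (rt_out (lr _ jt)) tj tree_mx_out //.
  by rewrite (skew_tree_mx r) tree_mx_out ?lr //; ring.
- have jl : j \notin labels l by apply: contraTN jt; apply: lr.
  have jx : (j == x) = false by apply: contraNF xr => /eqP<-.
  rewrite /= /edge /delta jx (rt_out it) (rt_out jl) tj (tree_mx_out _ it).
  by rewrite (skew_tree_mx l) tree_mx_out //; ring.
Qed.

Lemma tree_mx_child x l r t i j : uniq (labels (Nd x l r)) -> t = l \/ t = r ->
  i \in labels t -> j \in labels t -> tree_mx (Nd x l r) i j = tree_mx t i j.
Proof.
case/labels_uniq_node=> xl xr _ _ lr [] -> it jt.
- have nx k : k \in labels l -> (k == x) = false.
    by move=> kl; apply: contraNF xl => /eqP<-.
  rewrite /= /edge /delta !nx // !(@rt_out _ r) ?lr // (@tree_mx_out _ r) ?lr //; ring.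
- have rl k : k \in labels r -> k \notin labels l by apply: contraTN; apply: lr.
  have nx k : k \in labels r -> (k == x) = false.
    by move=> kr; apply: contraNF xr => /eqP<-.
  rewrite /= /edge /delta !nx // !(@rt_out _ l) ?rl // (@tree_mx_out _ l) ?rl //; ring.
Qed.

(** What has been assembled around [x] is the core and the subtree is the side. Hence [y] must be
    mutated once in the sequence of the subtree only; the core may mutate it twice, as happens in a
    3-cycle. *)
Lemma mgs_source_subtree b (S0 : pred V) x l r y l' r' t u1 u2 s1 s2 :
  skew_sym b -> uniq (labels (Nd x l r)) ->
  (forall i j, i \in labels (Nd x l r) -> j \in labels (Nd x l r) ->
     b i j = tree_mx (Nd x l r) i j) ->
  t = l \/ t = r -> t = Nd y l' r' -> S0 y ->
  (forall i, S0 i -> i \in labels (Nd x l r)) ->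
  (forall i, S0 i -> i \in labels t -> i = y) ->
  mgs_source b S0 x u1 u2 -> mgs_source b (fun i => i \in labels t) y s1 s2 ->
  mgs_source b (fun i => S0 i || (i \in labels t)) x (s1 ++ u1) (u2 ++ s2).
Proof.
move=> skb u bt tlr ty S0y S0t S0y' m0 m1.
have yt : y \in labels t by rewrite ty /= mem_head.
have tsub i : i \in labels t -> i \in labels (Nd x l r).
  by case: tlr => -> ?; rewrite /= inE mem_cat; apply/or3P; [apply: Or32|apply: Or33].
apply: (mgs_source_glue (w := y) _ _ _ _ _ m1 m0) => //.
move=> i j S0i iy jt jy; rewrite (bt _ _ (S0t i S0i) (tsub j jt)).
apply: (tree_mx_cross u tlr) => //.
  by apply: contraNN iy => it; rewrite (S0y' i S0i it).
by rewrite ty /= /delta (negbTE jy).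
Qed.

Lemma tree_mgs t (b : V -> V -> int) : skew_sym b -> uniq (labels t) ->
  (forall i j, i \in labels t -> j \in labels t -> b i j = tree_mx t i j) ->
  forall x l r, t = Nd x l r ->
  exists s1 s2, mgs_source b (fun i => i \in labels t) x s1 s2 /\
    (size s1 + size s2).+1 = (size (labels t) + triangles t)%N.
Proof.
move=> skb; elim: t => // x' l IHl r IHr u bt x _ _ [<- _ _] {x}; move: x' u bt => x u bt.
have [xl xr ul ur lr] := labels_uniq_node u.
have {}IHl : forall y l1 l2, l = Nd y l1 l2 ->
  exists s1 s2, mgs_source b (fun i => i \in labels l) y s1 s2 /\
    (size s1 + size s2).+1 = (size (labels l) + triangles l)%N.
  apply: IHl => // i j il jl; rewrite bt ?(tree_mx_child (t := l) u) //; first by left.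
    by rewrite /= inE mem_cat il orbT.
  by rewrite /= inE mem_cat jl orbT.
have {}IHr : forall y l1 l2, r = Nd y l1 l2 ->
  exists s1 s2, mgs_source b (fun i => i \in labels r) y s1 s2 /\
    (size s1 + size s2).+1 = (size (labels r) + triangles r)%N.
  apply: IHr => // i j il jl; rewrite bt ?(tree_mx_child (t := r) u) //; first by right.
    by rewrite /= inE mem_cat il !orbT.
  by rewrite /= inE mem_cat jl !orbT.
have bself i : b i i = 0 by have := skb i i; lia.
have szt : (size (labels (Nd x l r)) + triangles (Nd x l r) =
  (size (labels l) + size (labels r)).+1 +
  ((is_node l && is_node r) + triangles l + triangles r))%N by rewrite /= size_cat.
(* The triangle below [x] gives a point, an arrow with head [x] (right child), an arrow with tail
   [x] (left child) or a 3-cycle. *)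
case El: l => [p|y l1 l2]; case Er: r => [q|z r1 r2].
- exists [::], [::]; split=> //.
  apply: (@mgs_source_map unit V (fun=> x) predT _ (fun _ _ => 0) b _ _ _ _ tt [::] [::]
    mgs_source_point).
  + by move=> [] [].
  + by move=> i j; rewrite bself.
  + by move=> i; rewrite /= mem_head.
  + by move=> v; rewrite /= inE => /eqP->; exists tt.
- have [s1 [s2 [m sz]]] := IHr _ _ _ Er.
  have xz : x != z by apply: contraNneq xr => ->; rewrite Er /= mem_head.
  have zt : z \in labels r by rewrite Er /= mem_head.
  pose f (i : bool) := if i then z else x.
  have injf : injective f by move=> [] [] //= /eqP; rewrite ?(negbTE xz) // eq_sym (negbTE xz).
  have eb i j : arrow_mx i j = b (f i) (f j).
    have bzx : b z x = 1.
      have rtl v : rt l v = 0 by rewrite El.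
      have rtr v : rt r v = delta z v by rewrite Er.
      rewrite bt /= ?inE ?mem_cat ?eqxx ?zt ?orbT // (skew_tree_mx l) (skew_tree_mx r).
      rewrite !tree_mx_out // /edge !rtl !rtr /delta !eqxx eq_sym (negbTE xz); ring.
    by case: i j => [] []; rewrite /= ?bself // ?bzx // skb bzx.
  have m0 : mgs_source b (fun v => (v == x) || (v == z)) x [:: z] [::].
    apply: (mgs_source_map (f := f) (S := predT) injf eb _ _ mgs_source_head).
      by case; rewrite /= eqxx ?orbT.
    by move=> v /orP[]/eqP->; [exists false | exists true].
  have m' : mgs_source b (fun v => (v == x) || (v == z) || (v \in labels r)) x
    (s1 ++ [:: z]) ([::] ++ s2).
    apply: (mgs_source_subtree (t := r) skb u bt (or_intror erefl) Er _ _ _ m0 m).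
    + by rewrite eqxx orbT.
    + by move=> v /orP[]/eqP->; rewrite /= inE ?eqxx // mem_cat zt !orbT.
    + by move=> v /orP[]/eqP-> // xr'; rewrite xr' in xr.
  exists (s1 ++ [:: z]), ([::] ++ s2); split.
    rewrite -El -Er; apply: eq_mgs_source m'.
    move=> v /=; rewrite El /= inE; case: (v =P z) => [->|_]; last by rewrite orbF.
    by rewrite zt !orbT.
  rewrite -El -Er szt; have [-> -> ->] : [/\ labels l = [::], is_node l = false & triangles l = 0%N] by rewrite El.
  by rewrite size_cat /=; clear -sz; lia.
- have [s1 [s2 [m sz]]] := IHl _ _ _ El.
  have xy : x != y by apply: contraNneq xl => ->; rewrite El /= mem_head.
  have yt : y \in labels l by rewrite El /= mem_head.
  pose f (i : bool) := if i then x else y.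
  have injf : injective f by move=> [] [] //= /eqP; rewrite ?(negbTE xy) // eq_sym (negbTE xy).
  have eb i j : arrow_mx i j = b (f i) (f j).
    have bxy : b x y = 1.
      have rtl v : rt l v = delta y v by rewrite El.
      have rtr v : rt r v = 0 by rewrite Er.
      rewrite bt /= ?inE ?mem_cat ?eqxx ?yt ?orbT // !tree_mx_out //.
      rewrite /edge !rtl !rtr /delta !eqxx (negbTE xy); ring.
    by case: i j => [] []; rewrite /= ?bself // ?bxy // skb bxy.
  have m0 : mgs_source b (fun v => (v == x) || (v == y)) x [::] [:: y].
    apply: (mgs_source_map (f := f) (S := predT) injf eb _ _ mgs_source_tail).
      by case; rewrite /= eqxx ?orbT.
    by move=> v /orP[]/eqP->; [exists true | exists false].
  have m' : mgs_source b (fun v => (v == x) || (v == y) || (v \in labels l)) x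
    (s1 ++ [::]) ([:: y] ++ s2).
    apply: (mgs_source_subtree (t := l) skb u bt (or_introl erefl) El _ _ _ m0 m).
    + by rewrite eqxx orbT.
    + by move=> v /orP[]/eqP->; rewrite /= inE ?eqxx // mem_cat yt !orbT.
    + by move=> v /orP[]/eqP-> // xl'; rewrite xl' in xl.
  exists (s1 ++ [::]), ([:: y] ++ s2); split.
    rewrite -El -Er; apply: eq_mgs_source m'.
    move=> v /=; rewrite Er /= cats0 inE; case: (v =P y) => [->|_]; last by rewrite orbF.
    by rewrite yt !orbT.
  rewrite -El -Er szt andbC.
  have [-> -> ->] : [/\ labels r = [::], is_node r = false & triangles r = 0%N] by rewrite Er.
  by rewrite size_cat /=; clear -sz; lia.
- have [s1 [s2 [m sz]]] := IHl _ _ _ El.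
  have [s3 [s4 [m3 sz3]]] := IHr _ _ _ Er.
  have yt : y \in labels l by rewrite El /= mem_head.
  have zt : z \in labels r by rewrite Er /= mem_head.
  have yr : y \notin labels r by apply: lr.
  have zl : z \notin labels l by apply: contraTN zt; apply: lr.
  have xy : (x == y) = false by apply: contraNF xl => /eqP->.
  have xz : (x == z) = false by apply: contraNF xr => /eqP->.
  have yz : (y == z) = false by apply: contraNF yr => /eqP->.
  pose f (i : option bool) := if i is Some i then (if i then y else z) else x.
  have eqs := (xy, xz, yz, eq_sym y x, eq_sym z x, eq_sym z y).
  have injf : injective f by move=> [[]|] [[]|] //= /eqP; rewrite ?eqs.
  have [xt' yt' zt'] : [/\ x \in labels (Nd x l r), y \in labels (Nd x l r) &
                           z \in labels (Nd x l r)].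
    by rewrite /= !inE !mem_cat eqxx yt zt !orbT.
  have rtl v : rt l v = delta y v by rewrite El.
  have rtr v : rt r v = delta z v by rewrite Er.
  have eb i j : cycle3_mx i j = b (f i) (f j).
    have bxy : b x y = 1.
      rewrite bt //= (tree_mx_out _ xl) (tree_mx_out _ xr) /edge rtl !rtr /delta eqxx !eqs.
      by rewrite ?eqxx; ring.
    have bxz : b x z = -1.
      rewrite bt //= (tree_mx_out _ xl) (tree_mx_out _ xr) /edge !rtl !rtr /delta !eqxx !eqs.
      by ring.
    have byz : b y z = 1.
      rewrite bt //= (tree_mx_out _ yr) (skew_tree_mx l) (tree_mx_out _ zl) /edge.
      by rewrite !rtl !rtr /delta !eqxx !eqs; ring.
    by case: i j => [[]|] [[]|]; rewrite /= ?bself // ?bxy ?bxz ?byz // skb ?bxy ?bxz ?byz.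
  have m0 : mgs_source b (fun v => [|| v == x, v == y | v == z]) x [:: z] [:: y; z].
    apply: (mgs_source_map (f := f) (S := predT) injf eb _ _ mgs_source_cycle3).
      by case=> [[]|]; rewrite /= eqxx ?orbT.
    by move=> v /or3P[]/eqP->; [exists None | exists (Some true) | exists (Some false)].
  have m' : mgs_source b (fun v => [|| v == x, v == y | v == z] || (v \in labels l)) x
    (s1 ++ [:: z]) ([:: y; z] ++ s2).
    apply: (mgs_source_subtree (t := l) skb u bt (or_introl erefl) El _ _ _ m0 m).
    + by rewrite eqxx orbT.
    + by move=> v /or3P[]/eqP->.
    + move=> v /or3P[]/eqP-> // h; first by rewrite h in xl.
      by rewrite h in zl.
  have m'' : mgs_source b
    (fun v => [|| v == x, v == y | v == z] || (v \in labels l) || (v \in labels r)) x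
    (s3 ++ s1 ++ [:: z]) (([:: y; z] ++ s2) ++ s4).
    apply: (mgs_source_subtree (t := r) skb u bt (or_intror erefl) Er _ _ _ m' m3).
    + by rewrite eqxx !orbT.
    + by move=> v /orP[/or3P[]/eqP->|vl] //; rewrite /= inE mem_cat vl !orbT.
    + move=> v /orP[/or3P[]/eqP->|vl] // h; first by rewrite h in xr.
        by rewrite h in yr.
      by have := lr v vl; rewrite h.
  exists (s3 ++ s1 ++ [:: z]), (([:: y; z] ++ s2) ++ s4); split.
    rewrite -El -Er; apply: eq_mgs_source m''.
    move=> v /=; rewrite inE mem_cat; case: (v =P y) => [->|_].
      by rewrite yt !orbT.
    by case: (v =P z) => [->|_]; rewrite ?zt ?orbT //= orbF orbA.
  rewrite -El -Er szt; have [-> ->] : is_node l = true /\ is_node r = true by rewrite El Er.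
  by rewrite !size_cat /=; clear -sz sz3; lia.
Qed.

End TreeMgs.

Section CenterMgs.
Local Open Scope ring_scope.
Variable V : eqType.

(** This is the value [n + t]: a 3-cycle is a triangle with three inner sides, that is, a node with
    two inner children. *)
Definition ctr_size (c : center V) : nat :=
  (size (clabels c) + triangles (Nd (ck c) (cl1 c) (cr1 c))
   + triangles (Nd (ck c) (cl2 c) (cr2 c)))%N.

Lemma ctr_mgs (c : center V) (b : V -> V -> int) :
  skew_sym b -> wf c -> (forall v, v \in clabels c) ->
  (forall i j, b i j = ctr_mx c i j) ->
  exists s1 s2, mgs_source b predT (ck c) s1 s2 /\ (size s1 + size s2).+1 = ctr_size c.
Proof.
case: c => k l1 r1 l2 r2 skb wfc cov bE.
have [n1 n2 n3 n4] := wf_notin wfc; case/andP: wfc => /andP[_ u] _.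
rewrite /= in n1 n2 n3 n4 *.
have {}u : uniq (labels l1 ++ labels r1 ++ labels l2 ++ labels r2) by [].
move: u; rewrite catA cat_uniq => /and3P[u1 /hasPn u12 u2].
pose t1 := Nd k l1 r1; pose t2 := Nd k l2 r2.
have ut1 : uniq (labels t1) by rewrite /= mem_cat negb_or n1 n2.
have ut2 : uniq (labels t2) by rewrite /= mem_cat negb_or n3 n4.
have t12 i : i != k -> i \in labels t1 -> i \notin labels t2.
  move=> ik; rewrite /= !inE (negbTE ik) /= => i1; apply: contraTN i1.
  by move=> i2; apply: u12.
have t21 i : i != k -> i \in labels t2 -> i \notin labels t1.
  by move=> ik; apply: contraTN; apply: t12.
have bt t t' i j : (forall i, i != k -> i \in labels t -> i \notin labels t') ->
    i \in labels t -> j \in labels t -> tree_mx t' i j = 0.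
  move=> tt' it jt; have [ik|ik] := eqVneq i k; last by rewrite tree_mx_out ?tt'.
  have [jk|jk] := eqVneq j k; last by rewrite skew_tree_mx tree_mx_out ?oppr0 ?tt'.
  by rewrite ik jk; have := skew_tree_mx t' k k; lia.
have b1 i j : i \in labels t1 -> j \in labels t1 -> b i j = tree_mx t1 i j.
  by move=> i1 j1; rewrite bE -[RHS]addr0 -(bt t1 t2 i j).
have b2 i j : i \in labels t2 -> j \in labels t2 -> b i j = tree_mx t2 i j.
  by move=> i2 j2; rewrite bE -[RHS]add0r -(bt t2 t1 i j).
have [s1 [s2 [m1 sz1]]] := tree_mgs skb ut1 b1 erefl.
have [s3 [s4 [m2 sz2]]] := tree_mgs skb ut2 b2 erefl.
exists (s3 ++ s1), (s2 ++ s4); split.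
  apply: (@eq_mgs_source _ _ (fun i => (i \in labels t1) || (i \in labels t2))).
    move=> i /=; apply/idP; have := cov i; rewrite /clabels /= !inE !mem_cat.
    by case/or3P=> [->|->|/or3P[]->]; rewrite ?orbT.
  apply: (mgs_source_glue (w := k) _ _ _ skb _ m2 m1).
  - by rewrite /= mem_head.
  - by rewrite /= mem_head.
  - move=> i i1 i2; apply/eqP; apply: contraTT i2 => ik; exact: t12.
  - move=> i j i1 ik j2 jk; rewrite bE /ctr_mx -/t1 -/t2.
    by rewrite (tree_mx_out (t := t2)) ?t12 // skew_tree_mx tree_mx_out ?t21 //; ring.
rewrite /ctr_size /clabels -/t1 -/t2 !size_cat.
have e1 : size (labels t1) = (size (labels l1) + size (labels r1)).+1 by rewrite /= size_cat.
have e2 : size (labels t2) = (size (labels l2) + size (labels r2)).+1 by rewrite /= size_cat.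
move: (triangles t1) (triangles t2) sz1 sz2 => x1 x2 sz1 sz2.
by rewrite /= !size_cat; clear -sz1 sz2 e1 e2; lia.
Qed.

End CenterMgs.

(** * Shear coordinates *)

Section Laminations.
Local Open Scope ring_scope.
Variable V : eqType.
Implicit Types (t l r : tree V) (c : center V) (e : nat * nat) (P Q D : nat -> int).

Fixpoint lv t (p : nat) : int :=
  match t with
  | Lf q => if p == q then 1 else 0
  | Nd _ l r => lv l p + lv r p
  end.

Definition joins P Q e : int := P e.1 * Q e.2 + P e.2 * Q e.1.

(** [P] and [Q] are the leaf indicators of the other two sides of the triangle above the root, so
    that [l], [r], [P], [Q] surround the root edge in cyclic order, with [r] facing [Q] and [l]
    facing [P]. *)
Fixpoint tree_c t P Q j e : int :=
  if t is Nd y l r then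
    delta y j * (joins (lv r) Q e - joins (lv l) P e)
    + tree_c l (lv r) (fun p => P p + Q p) j e
    + tree_c r (fun p => P p + Q p) (lv l) j e
  else 0.

(* The c-vectors as shear coordinates: [e] is a curve joining two boundary edges
   (leaves), and its coordinate at [k] is [1], [-1] or [0] according to the pair
   of opposite sides through which it crosses the quadrilateral around [k]. *)
Definition ctr_c c j e : int :=
  tree_c (Nd (ck c) (cl1 c) (cr1 c)) (lv (cl2 c)) (lv (cr2 c)) j e
  + tree_c (cl2 c) (lv (cr2 c)) (fun p => lv (cl1 c) p + lv (cr1 c) p) j e
  + tree_c (cr2 c) (fun p => lv (cl1 c) p + lv (cr1 c) p) (lv (cl2 c)) j e.

Lemma tree_c_ext t P Q P' Q' j e :
  P =1 P' -> Q =1 Q' -> tree_c t P Q j e = tree_c t P' Q' j e.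
Proof.
elim: t P Q P' Q' => //= y l IHl r IHr P Q P' Q' eP eQ.
rewrite /joins !eP !eQ (IHl _ _ (lv r) (fun p => P' p + Q' p)) //; last first.
  by move=> p; rewrite eP eQ.
by rewrite (IHr _ _ (fun p => P' p + Q' p) (lv l)) // => p; rewrite eP eQ.
Qed.

(** A flip moves a block [D] from one neighbour of a side to the other. Below the root only the sum
    of [P] and [Q] enters, so only the coordinate at the root changes. *)
Lemma tree_c_shift t P P' Q Q' D j e :
  (forall p, P' p = P p + D p) -> (forall p, Q' p = Q p + D p) ->
  tree_c t P' Q j e = tree_c t P Q' j e - rt t j * joins (lv t) D e.
Proof.
move=> eP eQ; case: t => [q|y l r] /=; first by ring.
have ePQ p : P' p + Q p = P p + Q' p by rewrite eP eQ; ring.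
rewrite (@tree_c_ext l (lv r) _ (lv r) _ j e (fun=> erefl) ePQ).
rewrite (@tree_c_ext r _ (lv l) _ (lv l) j e ePQ (fun=> erefl)).
by rewrite /joins !eP !eQ /=; ring.
Qed.

Lemma recenter_c c c' j e : recenter c c' -> ctr_c c j e = ctr_c c' j e.
Proof.
by elim=> {c c'} // *; etransitivity; try eassumption;
  rewrite /ctr_c /joins /= /joins /=; ring.
Qed.

Lemma lv_mem t p : uniq (leaves t) -> lv t p = if p \in leaves t then 1 else 0.
Proof.
elim: t => [q|y l IHl r IHr] /=; first by rewrite inE.
rewrite cat_uniq mem_cat => /and3P[ul /hasPn lr ur]; rewrite IHl // IHr //.
have [pr|_] := boolP (p \in leaves r); last by case: ifP.
by have /negbTE -> := lr p pr.
Qed.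

Lemma tree_c_out t P Q j p q :
  lv t p = 0 -> lv t q = 0 -> uniq (leaves t) -> tree_c t P Q j (p, q) = 0.
Proof.
elim: t P Q => //= y l IHl r IHr P Q; rewrite cat_uniq => + + /and3P[ul _ ur].
rewrite !lv_mem //; case: ifP => pl; case: ifP => pr // _; case: ifP => ql;
  case: ifP => qr // _.
rewrite IHl ?IHr ?lv_mem ?pl ?pr ?ql ?qr // /joins /= !lv_mem // ?pl ?pr ?ql ?qr.
by ring.
Qed.

Lemma ctr_c_center c e : wf c ->
  ctr_c c (ck c) e
  = joins (lv (cr1 c)) (lv (cr2 c)) e - joins (lv (cl1 c)) (lv (cl2 c)) e.
Proof.
move=> /wf_notin[n1 n2 n3 n4].
have out t P Q j : j \notin labels t -> tree_c t P Q j e = 0.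
  elim: t P Q => //= y l IHl r IHr P Q; rewrite inE mem_cat !negb_or.
  by case/and3P=> /negbTE jy jl jr; rewrite IHl // IHr // /delta jy; ring.
by rewrite /ctr_c /= !out // /delta eqxx; ring.
Qed.

Lemma wf_leaf c p : wf c ->
  [/\ lv (cl1 c) p + lv (cr1 c) p + lv (cl2 c) p + lv (cr2 c) p <= 1,
      0 <= lv (cl1 c) p, 0 <= lv (cr1 c) p, 0 <= lv (cl2 c) p & 0 <= lv (cr2 c) p].
Proof.
case/andP=> _; rewrite /word; set a := leaves _; set b := leaves _.
set d := leaves _; set f := leaves _ => u.
have := count_uniq_mem p u; rewrite !count_cat.
move: u; rewrite !cat_uniq => /and3P[ua _ /and3P[ub _ /and3P[ud _ uf]]].
rewrite !lv_mem // -/a -/b -/d -/f !count_uniq_mem // => h.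
have : (nat_of_bool (p \in a ++ b ++ d ++ f) <= 1)%N by case: (_ \in _).
rewrite -h; case: (p \in a); case: (p \in b); case: (p \in d); case: (p \in f) => //= _.
Qed.

(** A leaf lies in at most one of the four sides, so a curve cannot join both pairs of opposite
    sides. *)
Lemma pos_ctr_c c e : wf c ->
  pos (ctr_c c (ck c) e) = joins (lv (cr1 c)) (lv (cr2 c)) e /\
  pos (- ctr_c c (ck c) e) = joins (lv (cl1 c)) (lv (cl2 c)) e.
Proof.
move=> wfc; rewrite ctr_c_center // /joins.
have [] := wf_leaf e.1 wfc; have [] := wf_leaf e.2 wfc.
move: (lv _ e.1) (lv _ e.1) (lv _ e.1) (lv _ e.1) => a4 a3 a2 a1.
move: (lv _ e.2) (lv _ e.2) (lv _ e.2) (lv _ e.2) => b4 b3 b2 b1.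
move=> hb hb1 hb2 hb3 hb4 ha ha1 ha2 ha3 ha4.
have c01 (z : int) : 0 <= z -> z <= 1 -> z = 0 \/ z = 1 by lia.
have [la1 la2 la3 la4] : [/\ a1 <= 1, a2 <= 1, a3 <= 1 & a4 <= 1] by split; lia.
have [lb1 lb2 lb3 lb4] : [/\ b1 <= 1, b2 <= 1, b3 <= 1 & b4 <= 1] by split; lia.
case: (c01 _ ha1 la1) (c01 _ ha2 la2) (c01 _ ha3 la3) (c01 _ ha4 la4) ha
  => [->|->] [->|->] [->|->] [->|->] // _;
case: (c01 _ hb1 lb1) (c01 _ hb2 lb2) (c01 _ hb3 lb3) (c01 _ hb4 lb4) hb
  => [->|->] [->|->] [->|->] [->|->] // _; by [].
Qed.

(** The curves [E v] stay those of the initial triangulation while [M] and [c] change along the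
    sequence. *)
Record rep (E : V -> nat * nat) (M : V + V -> V + V -> int) c : Prop := Rep {
  rep_skew : skew_sym M;
  rep_mx : forall i j, M (inl i) (inl j) = ctr_mx c i j;
  rep_c : forall i v, M (inl i) (inr v) = ctr_c c i (E v) }.

Lemma rep_recenter E M c c' : recenter c c' -> rep E M c -> rep E M c'.
Proof.
move=> rc [sk mx cv]; split=> // i j; first by rewrite mx (recenter_mx _ _ rc).
by rewrite cv (recenter_c _ _ rc).
Qed.

Lemma rep_flip E M c : wf c -> rep E M c -> rep E (mu (inl (ck c)) M) (flip c).
Proof.
move=> wfc [sk mx cv]; have eqi i : (inl i == inl (ck c) :> V + V) = (i == ck c) by [].
split; first exact: skew_mu.
  by move=> i j; rewrite -ctr_mx_flip // /mu !eqi !mx.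
move=> i v; rewrite /mu eqi orbF; have [->|ik] := eqVneq i (ck c).
  rewrite cv ctr_c_center // -[in RHS]/(ck (flip c)) ctr_c_center ?flip_wf //=.
  by rewrite /joins; ring.
rewrite (sk (inr v)) (sk (inl i) (inl _)) !mx !cv.
have [-> ->] := pos_ctr_c (E v) wfc; have [-> ->] := pos_ctr_mx i wfc.
rewrite /ctr_c /= /delta (negbTE ik).
(* For each of the four sides, the block that changes neighbour is the side facing it. *)
rewrite (@tree_c_shift (cl1 c) (lv (cr1 c)) _ (lv (cr2 c))
  (fun p => lv (cl2 c) p + lv (cr2 c) p) (lv (cl2 c))) //; last by move=> p; rewrite addrC.
rewrite (@tree_c_shift (cl2 c) (lv (cr2 c)) _ (lv (cr1 c))
  (fun p => lv (cl1 c) p + lv (cr1 c) p) (lv (cl1 c))) //; last by move=> p; rewrite addrC.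
rewrite (@tree_c_shift (cr1 c) (lv (cl2 c)) (fun p => lv (cl2 c) p + lv (cr2 c) p)
  (lv (cl1 c)) (fun p => lv (cr2 c) p + lv (cl1 c) p) (lv (cr2 c))) //;
  last by move=> p; rewrite addrC.
rewrite (@tree_c_shift (cr2 c) (lv (cl1 c)) (fun p => lv (cl1 c) p + lv (cr1 c) p)
  (lv (cl2 c)) (fun p => lv (cr1 c) p + lv (cl2 c) p) (lv (cr1 c))) //;
  last by move=> p; rewrite addrC.
by rewrite /joins; ring.
Qed.

End Laminations.

(** * The turned arcs of the initial triangulation *)

Section Ends.
Variable V : eqType.
Implicit Types (t l r : tree V) (c : center V) (E : V -> nat * nat).

Fixpoint lst t : nat := match t with Lf p => p | Nd _ _ r => lst r end.

Lemma lst_mem t : lst t \in leaves t.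
Proof. by elim: t => [p|y l _ r IHr] /=; rewrite ?mem_head // mem_cat IHr orbT. Qed.

Definition same_ends (e : nat * nat) p q : Prop := e = (p, q) \/ e = (q, p).

(* [p] is the leaf preceding the leaves of [t] in the cyclic order. *)
Fixpoint tree_ends E t p : Prop :=
  if t is Nd y l r then
    [/\ same_ends (E y) (lst r) p, tree_ends E l p & tree_ends E r (lst l)]
  else True.

(** Turning an arc moves each of its ends to the boundary edge just before it in the cyclic order;
    seen from either side of the arc this is a last leaf. *)
Definition ctr_ends E c : Prop :=
  [/\ tree_ends E (Nd (ck c) (cl1 c) (cr1 c)) (lst (cr2 c)),
      tree_ends E (cl2 c) (lst (cr1 c)) & tree_ends E (cr2 c) (lst (cl2 c))].

Lemma recenter_ends E c c' : recenter c c' -> ctr_ends E c -> ctr_ends E c'.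
Proof.
have sw e p q : same_ends e p q -> same_ends e q p by case; [right | left].
elim=> {c c'} //.
- move=> k l1 r1 l2 r2 c _ IH [[s1 s2 s3] s4 s5]; apply: IH.
  by split=> //; split=> //; apply: sw.
- move=> k y l r r1 l2 r2 c _ IH [[s1 [s2 s3 s4] s5] s6 s7]; apply: IH.
  by split=> //; split=> //; apply: sw.
- move=> k l1 y l r l2 r2 c _ IH [[s1 s2 [s3 s4 s5]] s6 s7]; apply: IH.
  by split=> //; split=> //; apply: sw.
Qed.

Lemma tree_ends_eq E E' t p :
  {in labels t, E =1 E'} -> tree_ends E t p -> tree_ends E' t p.
Proof.
elim: t p => //= y l IHl r IHr p eqE [ey el er]; split.
- by rewrite -eqE ?mem_head.
- by apply: IHl el => v vl; apply: eqE; rewrite inE mem_cat vl orbT.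
- by apply: IHr er => v vl; apply: eqE; rewrite inE mem_cat vl !orbT.
Qed.

Lemma tree_ends_ex t p : uniq (labels t) -> exists E, tree_ends E t p.
Proof.
elim: t p => [q|y l IHl r IHr] p; first by exists (fun=> (p, p)).
move=> /labels_uniq_node[yl yr ul ur lr]; have [El el] := IHl p ul.
have [Er er] := IHr (lst l) ur.
exists (fun v => if v == y then (lst r, p) else if v \in labels l then El v else Er v).
split; first by rewrite eqxx; left.
  apply: tree_ends_eq el => v vl; rewrite vl.
  by case: eqP => // vy; rewrite -vy vl in yl.
apply: tree_ends_eq er => v vr; rewrite ifN; last by apply: contraTneq vr => ->.
by rewrite ifN //; apply: contraTN vr; apply: lr.
Qed.

Lemma ctr_ends_ex c : wf c -> exists E, ctr_ends E c.
Proof.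
move=> /andP[uc _]; pose t := Nd (ck c) (cl1 c) (cr1 c).
have : uniq (labels t ++ labels (cl2 c) ++ labels (cr2 c)).
  by move: uc; rewrite /clabels /t /= -catA.
rewrite !cat_uniq has_cat negb_or => /and3P[ut /andP[/hasPn nl /hasPn nr]].
case/and3P=> ul /hasPn lr ur.
have [E1 e1] := tree_ends_ex (lst (cr2 c)) ut.
have [E2 e2] := tree_ends_ex (lst (cr1 c)) ul.
have [E3 e3] := tree_ends_ex (lst (cl2 c)) ur.
exists (fun v => if v \in labels t then E1 v else
                 if v \in labels (cl2 c) then E2 v else E3 v).
split.
- by apply: tree_ends_eq e1 => v ->.
- by apply: tree_ends_eq e2 => v vl; rewrite vl ifN // nl.
- by apply: tree_ends_eq e3 => v vr; rewrite !ifN ?nr ?lr.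
Qed.

Lemma tree_ends_mem E t p v : tree_ends E t p -> v \in labels t ->
  (E v).1 \in p :: leaves t /\ (E v).2 \in p :: leaves t.
Proof.
elim: t p => //= y l IHl r IHr p [ey el er]; rewrite inE mem_cat.
case/or3P=> [/eqP->|vl|vr].
- by case: ey => -> /=; rewrite !inE !mem_cat lst_mem eqxx !orbT.
- have [] := IHl _ el vl; rewrite !inE !mem_cat.
  by move=> /orP[]-> /orP[]->; rewrite ?orbT.
- have [] := IHr _ er vr; rewrite !inE !mem_cat.
  by move=> /orP[/eqP->|->] /orP[/eqP->|->]; rewrite ?lst_mem ?orbT.
Qed.

Local Open Scope ring_scope.

Lemma tree_c_swap t P Q j p q : tree_c t P Q j (p, q) = tree_c t P Q j (q, p).
Proof.
by elim: t P Q => //= y l IHl r IHr P Q; rewrite IHl IHr /joins /=; ring.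
Qed.

(** Inside [t] the curve runs towards the last leaf and passes every quadrilateral between adjacent
    sides, cutting off a corner. *)
Lemma tree_c_last t P Q j q : uniq (leaves t) -> Q (lst t) = 0 -> Q q = 0 ->
  lv t q = 0 -> tree_c t P Q j (lst t, q) = 0.
Proof.
elim: t P Q => //= y l IHl r IHr P Q u Qr Qq lrq.
move: (u); rewrite cat_uniq => /and3P[ul /hasPn lr ur].
have lq : lv l q = 0 /\ lv r q = 0.
  by move: lrq; rewrite !lv_mem //; case: ifP; case: ifP.
have lr0 : lv l (lst r) = 0 by rewrite lv_mem // (negbTE (lr _ (lst_mem r))).
case: lq => lq rq; rewrite IHr // tree_c_out // /joins /= lr0 lq rq Qr Qq; ring.
Qed.

(** This is the identity c-matrix of the framed quiver. *)
Lemma ctr_c_ends c i : wf c ->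
  ctr_c c i (lst (cr1 c), lst (cr2 c)) = (i == ck c)%:Z.
Proof.
move=> wfc; have [] := wf_leaf (lst (cr1 c)) wfc; have [] := wf_leaf (lst (cr2 c)) wfc.
have : uniq (word c) by case/andP: wfc.
rewrite /word !cat_uniq => /and3P[u1 _ /and3P[u2 _ /and3P[u3 _ u4]]].
have e1 : lv (cr1 c) (lst (cr1 c)) = 1 by rewrite lv_mem ?lst_mem.
have e2 : lv (cr2 c) (lst (cr2 c)) = 1 by rewrite lv_mem ?lst_mem.
rewrite e1 e2 => h2 a2 b2 d2 _ h1 a1 _ d1 f1.
have [z1 z2 z3] : [/\ lv (cl1 c) (lst (cr1 c)) = 0, lv (cl2 c) (lst (cr1 c)) = 0
  & lv (cr2 c) (lst (cr1 c)) = 0] by split; lia.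
have [y1 y2 y3] : [/\ lv (cl1 c) (lst (cr2 c)) = 0, lv (cl2 c) (lst (cr2 c)) = 0
  & lv (cr1 c) (lst (cr2 c)) = 0] by split; lia.
rewrite /ctr_c /= (tree_c_swap (cr2 c)).
rewrite !tree_c_last // !tree_c_out // /joins /= e1 e2 z1 z2 z3 y1 y2 y3.
by rewrite !(mulr0, mul0r, addr0, subr0, mulr1) /delta; case: (i == ck c).
Qed.

Lemma rep_framed E c b : skew_sym b -> wf c -> ctr_ends E c ->
  (forall v, v \in clabels c) -> (forall i j, b i j = ctr_mx c i j) ->
  rep E (framed_mx b) c.
Proof.
move=> skb wfc Ec cov bE; split=> //=; first exact: skew_framed_mx.
move=> i v; have [c' rc <-] := recenter_at (cov v).
have [[ev _ _] _ _] := recenter_ends rc Ec; rewrite (recenter_c _ _ rc).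
have := ctr_c_ends i (recenter_wf rc wfc).
case: ev => -> <- //; rewrite /ctr_c.
by rewrite (tree_c_swap (Nd _ _ _)) (tree_c_swap (cl2 c')) (tree_c_swap (cr2 c')).
Qed.

End Ends.

(** * Cyclic order and quadruples of boundary edges *)

Section Quartets.
Variable V : eqType.
Implicit Types (t l : tree V) (c : center V) (w A : seq nat) (p q r s x : nat).

Definition cyc3 (i j k : nat) : bool := [|| i < j < k, j < k < i | k < i < j].

Definition cy w p q r := cyc3 (index p w) (index q w) (index r w).

Lemma cy_rot w1 w2 p q r : uniq (w1 ++ w2) ->
  p \in w1 ++ w2 -> q \in w1 ++ w2 -> r \in w1 ++ w2 ->
  cy (w1 ++ w2) p q r = cy (w2 ++ w1) p q r.
Proof.
rewrite cat_uniq => /and3P[_ /hasPn dis _].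
have idx x : x \in w1 ++ w2 ->
    (index x (w1 ++ w2) < size w1 /\ index x (w2 ++ w1) = size w2 + index x (w1 ++ w2)) \/
    (size w1 <= index x (w1 ++ w2) < size w1 + size w2 /\
     index x (w1 ++ w2) = size w1 + index x (w2 ++ w1)).
  rewrite mem_cat !index_cat; have [x2 _|x2] := boolP (x \in w2).
    by rewrite (negbTE (dis x x2)) ltn_add2l index_mem x2 leq_addr; right.
  by rewrite orbF => x1; rewrite x1 index_mem x1; left.
move=> /idx hp /idx hq /idx hr; rewrite /cy /cyc3.
move: (index p _) (index q _) (index r _) (index p _) (index q _) (index r _) hp hq hr.
move: (size w1) (size w2) => n1 n2 i1 i2 i3 i4 i5 i6 hp hq hr.
by apply/idP/idP; clear -hp hq hr; lia.
Qed.

Definition same_cy w w' : Prop := perm_eq w w' /\ (uniq w ->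
  forall p q r, p \in w -> q \in w -> r \in w -> cy w p q r = cy w' p q r).

Lemma same_cy_trans w1 w2 w3 : same_cy w1 w2 -> same_cy w2 w3 -> same_cy w1 w3.
Proof.
move=> [p12 c12] [p23 c23]; split; first exact: perm_trans p12 p23.
move=> u p q r hp hq hr; rewrite c12 // c23 -?(perm_uniq p12) -?(perm_mem p12) //.
Qed.

Lemma same_cy_rot w1 w2 w w' : w = w1 ++ w2 -> w' = w2 ++ w1 -> same_cy w w'.
Proof.
move=> -> ->; split; first by rewrite perm_catC.
by move=> u p q r; apply: cy_rot.
Qed.

Lemma same_cy_recenter c c' : recenter c c' -> same_cy (word c) (word c').
Proof.
elim=> {c c'} //.
- move=> k l1 r1 l2 r2 c rc; apply: same_cy_trans.
  by apply: (@same_cy_rot (leaves l1 ++ leaves r1) (leaves l2 ++ leaves r2));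
    rewrite /word /= -?catA.
- move=> k y l r r1 l2 r2 c rc; apply: same_cy_trans.
  by apply: (@same_cy_rot [::] (leaves l ++ leaves r ++ leaves r1 ++ leaves l2 ++ leaves r2));
    rewrite /word /= ?cats0 -?catA.
- move=> k l1 y l r l2 r2 c rc; apply: same_cy_trans.
  by apply: (@same_cy_rot (leaves l1) (leaves l ++ leaves r ++ leaves l2 ++ leaves r2));
    rewrite /word /= -?catA.
Qed.

Lemma same_cy_flip c : same_cy (word c) (word (flip c)).
Proof.
by apply: (@same_cy_rot (leaves (cl1 c)) (leaves (cr1 c) ++ leaves (cl2 c) ++ leaves (cr2 c)));
  rewrite /word /= -?catA.
Qed.

(** The sides are numbered in cyclic order, so 0 faces 2 and 1 faces 3. *)
Definition blk c p : nat :=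
  if p \in leaves (cl1 c) then 0 else if p \in leaves (cr1 c) then 1
  else if p \in leaves (cl2 c) then 2 else 3.

Lemma blk_lt4 c p : blk c p < 4.
Proof. by rewrite /blk; do 3?case: ifP. Qed.

Lemma blkE c p : wf c -> p \in word c ->
  [/\ (p \in leaves (cl1 c)) = (blk c p == 0), (p \in leaves (cr1 c)) = (blk c p == 1),
      (p \in leaves (cl2 c)) = (blk c p == 2) & (p \in leaves (cr2 c)) = (blk c p == 3)].
Proof.
move=> /andP[_]; rewrite /word !cat_uniq !has_cat !negb_or !mem_cat /blk.
move=> /and3P[_ /and3P[/hasPn h1 /hasPn h2 /hasPn h3] /and3P[_ /andP[/hasPn h4 /hasPn h5]]].
case/and3P=> _ /hasPn h6 _; move: (h1 p) (h2 p) (h3 p) (h4 p) (h5 p) (h6 p).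
case: (p \in leaves (cl1 c)); case: (p \in leaves (cr1 c));
case: (p \in leaves (cl2 c)); case: (p \in leaves (cr2 c)) => //=;
  do ?[by move=> /(_ isT) | move=> _] => //.
Qed.

Lemma blk_index c p q : wf c -> p \in word c -> q \in word c ->
  blk c p < blk c q -> index p (word c) < index q (word c).
Proof.
move=> wfc hp hq; have [p1 p2 p3 p4] := blkE wfc hp; have [q1 q2 q3 q4] := blkE wfc hq.
have := blk_lt4 c p; have := blk_lt4 c q.
rewrite /word !index_cat p1 p2 p3 q1 q2 q3.
have ip A : p \in A -> index p A < size A by rewrite index_mem.
move: (ip (leaves (cl1 c))) (ip (leaves (cr1 c))) (ip (leaves (cl2 c))) (ip (leaves (cr2 c))).
rewrite p1 p2 p3 p4; move: (index p _) (index p _) (index p _) (index p _).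
move: (index q _) (index q _) (index q _) (index q _) (size _) (size _) (size _) (size _).
by move: (blk c p) (blk c q); clear=> [[|[|[|[|?]]]]] [|[|[|[|?]]]] //= *; lia.
Qed.

Lemma cyc3_asym i j k : cyc3 i j k -> ~~ cyc3 i k j.
Proof. by rewrite /cyc3; lia. Qed.

Lemma blk_cy c p q r : wf c -> p \in word c -> q \in word c -> r \in word c ->
  cyc3 (blk c p) (blk c q) (blk c r) -> cy (word c) p q r.
Proof.
move=> wfc hp hq hr; have lt := blk_index wfc.
rewrite /cy /cyc3 => /or3P[]/andP[h1 h2]; apply/or3P;
  [apply: Or31 | apply: Or32 | apply: Or33]; by rewrite !lt.
Qed.

Lemma cy_blk c p q r : wf c -> p \in word c -> q \in word c -> r \in word c ->
  cy (word c) p q r -> ~~ cyc3 (blk c p) (blk c r) (blk c q).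
Proof.
move=> wfc hp hq hr; apply: contraTN => /(blk_cy wfc hp hr hq).
exact: cyc3_asym.
Qed.

Definition sep A p q r s : bool :=
  [&& p \in A, q \in A, r \notin A & s \notin A] ||
  [&& p \notin A, q \notin A, r \in A & s \in A].

Fixpoint tree_q t p q r s : bool :=
  if t is Nd _ l l' then
    [|| sep (leaves l ++ leaves l') p q r s, tree_q l p q r s | tree_q l' p q r s]
  else false.

(* Some edge of the dual tree separates the leaves [p, q] from [r, s]. *)
Definition ctr_q c p q r s : bool :=
  [|| sep (leaves (cl1 c) ++ leaves (cr1 c)) p q r s,
      tree_q (cl1 c) p q r s, tree_q (cr1 c) p q r s,
      tree_q (cl2 c) p q r s | tree_q (cr2 c) p q r s].

Lemma sep_compl A B p q r s : uniq (A ++ B) ->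
  p \in A ++ B -> q \in A ++ B -> r \in A ++ B -> s \in A ++ B ->
  sep A p q r s = sep B p q r s.
Proof.
rewrite cat_uniq => /and3P[_ /hasPn dis _].
have AB x : x \in A ++ B -> (x \in A) = (x \notin B).
  rewrite mem_cat => xAB; apply/idP/idP => [xA|]; last by move: xAB; case: (x \in A) => //= ->.
  by apply/negP => xB; have := dis x xB; rewrite /= xA.
by move=> /AB hp /AB hq /AB hr /AB hs; rewrite /sep hp hq hr hs !negbK orbC.
Qed.

Lemma recenter_q c c' p q r s : recenter c c' -> uniq (word c) ->
  p \in word c -> q \in word c -> r \in word c -> s \in word c ->
  ctr_q c p q r s = ctr_q c' p q r s.
Proof.
elim=> {c c'} //.
- move=> k l1 r1 l2 r2 c rc IH u hp hq hr hs.
  have [_ pm] := recenter_perm (rc_swap (rc_refl (Ctr k l2 r2 l1 r1))).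
  rewrite -IH -?(perm_uniq pm) -?(perm_mem pm) // /ctr_q /=.
  rewrite /word /= catA in u hp hq hr hs; rewrite (sep_compl u) //.
  by case: sep => //=; do 4!case: tree_q.
- move=> k y l r0 r1 l2 r2 c rc IH u hp hq hr hs.
  have [_ pm] := recenter_perm (rc_left (rc_refl (Ctr y l r0 r1 (Nd k l2 r2)))).
  rewrite -IH -?(perm_uniq pm) -?(perm_mem pm) // /ctr_q /=.
  rewrite /word /= [(_ ++ _) ++ _]catA in u hp hq hr hs; rewrite (sep_compl u) //.
  by do 2!case: sep; do 5!case: tree_q.
- move=> k l1 y l r0 l2 r2 c rc IH u hp hq hr hs.
  have [_ pm] := recenter_perm (rc_right (rc_refl (Ctr y l r0 (Nd k l2 r2) l1))).
  rewrite -IH -?(perm_uniq pm) -?(perm_mem pm) // /ctr_q /=.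
  rewrite /word /= catA in u hp hq hr hs; rewrite (sep_compl u) //.
  by do 2!case: sep; do 5!case: tree_q.
Qed.

Definition sepn (bp bq br bs : nat) : bool :=
  [&& (bp < 2) == (bq < 2), (br < 2) == (bs < 2) & (bp < 2) != (br < 2)].

Lemma sep_blk c p q r s : wf c ->
  p \in word c -> q \in word c -> r \in word c -> s \in word c ->
  sep (leaves (cl1 c) ++ leaves (cr1 c)) p q r s
  = sepn (blk c p) (blk c q) (blk c r) (blk c s).
Proof.
move=> wfc; have side x : x \in word c -> (x \in leaves (cl1 c) ++ leaves (cr1 c)) = (blk c x < 2).
  by move=> /(blkE wfc)[h1 h2 _ _]; rewrite mem_cat h1 h2; case: (blk c x) => [|[]].
move=> hp hq hr hs; rewrite /sep !side // /sepn.
by case: (blk c p < 2); case: (blk c q < 2); case: (blk c r < 2); case: (blk c s < 2).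
Qed.

Definition inner_q c p q r s : bool :=
  [|| tree_q (cl1 c) p q r s, tree_q (cr1 c) p q r s,
      tree_q (cl2 c) p q r s | tree_q (cr2 c) p q r s].

Lemma tree_q_mem t p q r s : tree_q t p q r s ->
  (p \in leaves t) && (q \in leaves t) || (r \in leaves t) && (s \in leaves t).
Proof.
elim: t => //= y l IHl l' IHl'; rewrite !mem_cat /sep !mem_cat.
case/or3P=> [|/IHl|/IHl']; last 2 first.
- by case/orP=> /andP[-> ->]; rewrite ?orbT.
- by case/orP=> /andP[-> ->]; rewrite !orbT.
by case/orP=> /and4P[]; [move=> -> -> | move=> _ _ -> ->]; rewrite ?orbT.
Qed.

Lemma tree_q_sep t p q r s : p != q -> r != s -> sep (leaves t) p q r s -> tree_q t p q r s.
Proof.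
move=> pq rs; case: t => [x|y l l'] /= h; last by rewrite h.
case/orP: h; rewrite !inE => /and4P[h1 h2 h3 h4].
  by rewrite (eqP h1) (eqP h2) eqxx in pq.
by rewrite (eqP h3) (eqP h4) eqxx in rs.
Qed.

(** Two distinct leaves in one side show that this side is an inner edge, and this edge cuts them
    off from the other two. *)
Lemma inner_q_same c p q r s : wf c -> p != q -> r != s ->
  p \in word c -> q \in word c -> r \in word c -> s \in word c ->
  [&& blk c p == blk c q, blk c r != blk c p & blk c s != blk c p] ||
  [&& blk c r == blk c s, blk c p != blk c r & blk c q != blk c r] ->
  inner_q c p q r s.
Proof.
move=> wfc pq rs hp hq hr hs h.
have [p1 p2 p3 p4] := blkE wfc hp; have [q1 q2 q3 q4] := blkE wfc hq.
have [r1 r2 r3 r4] := blkE wfc hr; have [s1 s2 s3 s4] := blkE wfc hs.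
have hb : (blk c p < 4) && (blk c r < 4) by rewrite !blk_lt4.
have h1 := @tree_q_sep (cl1 c) p q r s pq rs; have h2 := @tree_q_sep (cr1 c) p q r s pq rs.
have h3 := @tree_q_sep (cl2 c) p q r s pq rs; have h4 := @tree_q_sep (cr2 c) p q r s pq rs.
rewrite /inner_q; move: h1 h2 h3 h4; rewrite /sep p1 p2 p3 p4 q1 q2 q3 q4.
rewrite r1 r2 r3 r4 s1 s2 s3 s4; case/orP: h => /and3P[/eqP e n1 n2].
- rewrite -e; move: hb n1 n2; case: (blk c p) => [|[|[|[|?]]]] // _ n1 n2 h1 h2 h3 h4.
  + by rewrite h1 ?orbT // n1 n2 /= ?orbT.
  + by rewrite h2 ?orbT // n1 n2 /= ?orbT.
  + by rewrite h3 ?orbT // n1 n2 /= ?orbT.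
  + by rewrite h4 ?orbT // n1 n2 /= ?orbT.
- rewrite -e; move: hb n1 n2; case: (blk c r) => [|[|[|[|?]]]];
    rewrite ?andbF // => _ n1 n2 h1 h2 h3 h4.
  + by rewrite h1 ?orbT // n1 n2 /= ?orbT.
  + by rewrite h2 ?orbT // n1 n2 /= ?orbT.
  + by rewrite h3 ?orbT // n1 n2 /= ?orbT.
  + by rewrite h4 ?orbT // n1 n2 /= ?orbT.
Qed.

Lemma inner_q_diff c p q r s : wf c ->
  p \in word c -> q \in word c -> r \in word c -> s \in word c ->
  inner_q c p q r s -> (blk c p == blk c q) || (blk c r == blk c s).
Proof.
move=> wfc hp hq hr hs; have [p1 p2 p3 p4] := blkE wfc hp; have [q1 q2 q3 q4] := blkE wfc hq.
have [r1 r2 r3 r4] := blkE wfc hr; have [s1 s2 s3 s4] := blkE wfc hs.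
case/or4P=> /tree_q_mem; rewrite ?(p1, p2, p3, p4) ?(q1, q2, q3, q4) ?(r1, r2, r3, r4)
  ?(s1, s2, s3, s4) => /orP[]/andP[/eqP-> /eqP->]; by rewrite eqxx ?orbT.
Qed.

Lemma ctr_qE c p q r s : wf c ->
  p \in word c -> q \in word c -> r \in word c -> s \in word c ->
  ctr_q c p q r s = sepn (blk c p) (blk c q) (blk c r) (blk c s) || inner_q c p q r s.
Proof. by move=> *; rewrite /ctr_q sep_blk. Qed.

Lemma inner_q_flip c p q r s : inner_q (flip c) p q r s = inner_q c p q r s.
Proof. by rewrite /inner_q /=; do 4!case: tree_q. Qed.

Lemma blk_flip c p : wf c -> p \in word c -> blk (flip c) p = (blk c p + 3) %% 4.
Proof.
move=> wfc hp; have [h1 h2 h3 h4] := blkE wfc hp.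
by rewrite {1}/blk /= h2 h3 h4; case: (blk c p) (blk_lt4 c p) => [|[|[|[|]]]].
Qed.

Definition cyc4 w p q r s : bool :=
  [&& cy w p q r, cy w q r s, cy w r s p & cy w s p q].

Lemma cyc4_neq w p q r s : cyc4 w p q r s -> p != q /\ r != s.
Proof.
case/and4P=> h1 h2 h3 _; split.
  by apply: contraTneq h1 => ->; rewrite /cy /cyc3; lia.
by apply: contraTneq h2 => ->; rewrite /cy /cyc3; lia.
Qed.

Definition all_lt4 (P : pred nat) := all P (iota 0 4).

Lemma all_lt4P P n : all_lt4 P -> n < 4 -> P n.
Proof. by move=> /allP h n4; apply: h; rewrite mem_iota. Qed.

(** Only the diagonal changes, so the four leaves must lie in four different sides; the cyclic order
    and the topology before the flip leave two placements. *)
Lemma quartet_lost c p q r s : wf c ->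
  p \in word c -> q \in word c -> r \in word c -> s \in word c ->
  cyc4 (word c) p q r s -> ctr_q c p q r s -> ~~ ctr_q (flip c) p q r s ->
  [:: blk c p; blk c q; blk c r; blk c s] \in [:: [:: 0; 1; 2; 3]; [:: 2; 3; 0; 1]].
Proof.
move=> wfc hp hq hr hs c4; have [pq rs] := cyc4_neq c4.
have pm x : (x \in word (flip c)) = (x \in word c).
  by have [_ pm] := flip_perm c; rewrite (perm_mem pm).
rewrite !ctr_qE ?flip_wf ?pm // inner_q_flip negb_or => + /andP[_ ni].
rewrite (negbTE ni) orbF; move: ni => /(contraNN (inner_q_same wfc pq rs hp hq hr hs)).
case/and4P: c4 => /(cy_blk wfc hp hq hr) c1 /(cy_blk wfc hq hr hs) c2.
move=> /(cy_blk wfc hr hs hp) c3 /(cy_blk wfc hs hp hq) c4; move: c1 c2 c3 c4.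
move: (blk_lt4 c p) (blk_lt4 c q) (blk_lt4 c r) (blk_lt4 c s).
move: (blk c p) (blk c q) (blk c r) (blk c s) => bp bq br bs lp lq lr ls.
(* The claim depends on the four side numbers only and is checked on all their values. *)
have : all_lt4 (fun bp => all_lt4 (fun bq => all_lt4 (fun br => all_lt4 (fun bs =>
  [==> ~~ cyc3 bp br bq, ~~ cyc3 bq bs br, ~~ cyc3 br bp bs, ~~ cyc3 bs bq bp,
    ~~ ([&& bp == bq, br != bp & bs != bp] || [&& br == bs, bp != br & bq != br]),
    sepn bp bq br bs => [:: bp; bq; br; bs] \in [:: [:: 0; 1; 2; 3]; [:: 2; 3; 0; 1]]])))).
  by vm_compute.
move=> /all_lt4P/(_ lp)/all_lt4P/(_ lq)/all_lt4P/(_ lr)/all_lt4P/(_ ls).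
by do 6!move=> /implyP + /[dup] ? => /[apply].
Qed.

Lemma tree_q_recenter t p q r s : tree_q t p q r s ->
  forall k l2 (r2 : tree V) l l', t = Nd k l l' ->
  exists2 c, recenter (Ctr k l l' l2 r2) c & sep (leaves (cl1 c) ++ leaves (cr1 c)) p q r s.
Proof.
elim: t => //= y l IHl l' IHl' /or3P[sp|tl|tl'] k l2 r2 _ _ [<- <- <-].
- by exists (Ctr y l l' l2 r2) => //; apply: rc_refl.
- case: l IHl tl => // y1 l1 r1 IHl tl.
  by have [c rc sp] := IHl tl _ l' (Nd y l2 r2) _ _ erefl; exists c => //; apply: rc_left.
- case: l' IHl' tl' => // y1 l1 r1 IHl' tl'.
  by have [c rc sp] := IHl' tl' _ (Nd y l2 r2) l _ _ erefl; exists c => //; apply: rc_right.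
Qed.

Lemma ctr_q_recenter c p q r s : wf c ->
  p \in word c -> q \in word c -> r \in word c -> s \in word c -> ctr_q c p q r s ->
  exists c', [/\ recenter c c', p \in leaves (cl1 c') ++ leaves (cr1 c'),
    q \in leaves (cl1 c') ++ leaves (cr1 c'), r \in leaves (cl2 c') ++ leaves (cr2 c') &
    s \in leaves (cl2 c') ++ leaves (cr2 c')].
Proof.
move=> wfc hp hq hr hs cq.
have [c' rc sp] : exists2 c', recenter c c' & sep (leaves (cl1 c') ++ leaves (cr1 c')) p q r s.
  case: c cq {wfc hp hq hr hs} => k l1 r1 l2 r2 cq.
  have /orP[q1|q2] : tree_q (Nd k l1 r1) p q r s || tree_q (Nd k l2 r2) p q r s.
    by move: cq; rewrite /ctr_q /=; do 2!case: sep; do 4!case: tree_q.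
  - exact: tree_q_recenter q1 _ _ _ _ _ erefl.
  - have [c' rc sp] := tree_q_recenter q2 l1 r1 erefl.
    by exists c' => //; apply: rc_swap.
have [pm _] := same_cy_recenter rc; rewrite !(perm_mem pm) {pm} in hp hq hr hs.
have cat c1 : word c1 = (leaves (cl1 c1) ++ leaves (cr1 c1)) ++ leaves (cl2 c1) ++ leaves (cr2 c1).
  by rewrite /word catA.
rewrite !cat !(mem_cat _ (_ ++ _)) in hp hq hr hs.
case/orP: sp => /and4P[h1 h2 h3 h4].
  by exists c'; split=> //; [move: hr | move: hs]; rewrite ?(negbTE h3) ?(negbTE h4).
exists (Ctr (ck c') (cl2 c') (cr2 c') (cl1 c') (cr1 c')); split=> //=.
- apply: recenter_trans rc _; case: c' {h1 h2 h3 h4 hp hq hr hs} => *.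
  by apply: rc_swap; apply: rc_refl.
- by move: hp; rewrite (negbTE h1).
- by move: hq; rewrite (negbTE h2).
Qed.

(** Descend to the left as long as [q] lies there. Since [p] comes before [q] as seen from [s], it
    lies there too, and [p != q] prevents the descent from ending in a leaf. *)
Lemma turn_right t p q s : p != q -> p \in leaves t -> q \in leaves t ->
  forall k l (r : tree V) l2 (r2 : tree V), t = Nd k l r -> wf (Ctr k l r l2 r2) ->
  s \in leaves l2 ++ leaves r2 -> cy (word (Ctr k l r l2 r2)) s p q ->
  exists c, [/\ recenter (Ctr k l r l2 r2) c, q \in leaves (cr1 c),
    forall x, x \in leaves r2 -> x \in leaves (cr2 c) &
    forall x, x \in leaves l2 ++ leaves r2 -> x \in leaves (cl2 c) ++ leaves (cr2 c)].
Proof.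
move=> pq; elim: t => [x|y l IHl r _] /= pt qt k ? ? l2 r2 // [<- <- <-] wfc hs hc.
have [qr|qr] := boolP (q \in leaves r).
  by exists (Ctr y l r l2 r2); split=> //; apply: rc_refl.
have ql : q \in leaves l by move: qt; rewrite mem_cat (negbTE qr) orbF.
have [hpw hqw hsw] : [/\ p \in word (Ctr y l r l2 r2), q \in word (Ctr y l r l2 r2) &
                       s \in word (Ctr y l r l2 r2)].
  by rewrite /word /= catA !(mem_cat _ (_ ++ _)) pt qt hs orbT.
have pl : p \in leaves l.
  have := cy_blk wfc hsw hpw hqw hc.
  have [p1 p2 p3 p4] := blkE wfc hpw; have [q1 q2 q3 q4] := blkE wfc hqw.
  have [s1 s2 s3 s4] := blkE wfc hsw; move: pt ql hs; rewrite /= in p1 p2 q1 s3 s4.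
  rewrite !mem_cat p1 p2 q1 s3 s4; move: (blk _ p) (blk _ q) (blk _ s).
  by move=> [|[|?]] // [|?] // [|[|[|[|?]]]].
case: l IHl pl ql wfc hc {pt qt hpw hqw hsw} => [x|y1 l1 r1] IHl pl ql wfc hc.
  by move: pq pl ql; rewrite !inE => + /eqP e1 /eqP e2; rewrite e1 e2 eqxx.
have rc : recenter (Ctr y (Nd y1 l1 r1) r l2 r2) (Ctr y1 l1 r1 r (Nd y l2 r2)).
  exact/rc_left/rc_refl.
have e : word (Ctr y (Nd y1 l1 r1) r l2 r2) = word (Ctr y1 l1 r1 r (Nd y l2 r2)).
  by rewrite /word /= -!catA.
have [||c [rc' qc h1 h2]] := IHl pl ql y1 l1 r1 r (Nd y l2 r2) erefl (recenter_wf rc wfc).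
- by rewrite mem_cat hs orbT.
- by rewrite -e.
exists c; split=> //; first exact: recenter_trans rc rc'.
- by move=> x xr; apply: h1; rewrite /= mem_cat xr orbT.
- by move=> x xr; apply: h2; rewrite mem_cat xr orbT.
Qed.

(** Start from a separating edge and apply [turn_right] towards [q] on one side, then towards [s] on
    the other. At the edge so reached the curve from [q] to [s] has coordinate 1, which the final
    all-red state excludes. *)
Lemma quartet_shear c p q r s : wf c ->
  p \in word c -> q \in word c -> r \in word c -> s \in word c ->
  cyc4 (word c) p q r s -> ctr_q c p q r s ->
  exists c', [/\ recenter c c', s \in leaves (cr1 c') & q \in leaves (cr2 c')].
Proof.
move=> wfc hp hq hr hs c4 cq; have [pq rs] := cyc4_neq c4.
have [c1 [rc1 p1 q1 r1 s1]] := ctr_q_recenter wfc hp hq hr hs cq.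
case/and4P: c4 => _ cqrs _ cspq.
have uw : uniq (word c) by case/andP: wfc.
have tr c' x y z : recenter c c' -> x \in word c -> y \in word c -> z \in word c ->
    cy (word c) x y z -> cy (word c') x y z.
  by move=> rc hx hy hz h; have [_ cE] := same_cy_recenter rc; rewrite -cE.
have wf1 := recenter_wf rc1 wfc.
have cspq1 := tr _ _ _ _ rc1 hs hp hq cspq.
case: c1 rc1 p1 q1 r1 s1 wf1 cspq1 => k a1 b1 a2 b2 rc1 /= p1 q1 r1 s1 wf1 cspq1.
have [c2 [rc2 q2 _ h2]] := turn_right (t := Nd k a1 b1) pq p1 q1 erefl wf1 s1 cspq1.
have {}r1 := h2 _ r1; have {}s1 := h2 _ s1 => {h2 p1 q1 cspq1}.
have rc2' := recenter_trans rc1 rc2.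
case: c2 rc2 rc2' q2 r1 s1 => k2 d1 e1 d2 e2 rc2 rc2' /= q2 r1 s1.
have rc3 : recenter c (Ctr k2 d2 e2 d1 e1).
  by apply: recenter_trans rc2' _; apply/rc_swap/rc_refl.
have qd : q \in leaves d1 ++ leaves e1 by rewrite mem_cat q2 orbT.
have [c3 [rc4 s3 h3 _]] := turn_right (t := Nd k2 d2 e2) rs r1 s1 erefl
  (recenter_wf rc3 wfc) qd (tr _ _ _ _ rc3 hq hr hs cqrs).
by exists c3; split=> //; [apply: recenter_trans rc3 rc4 | apply: h3].
Qed.

Lemma index_lst t x : uniq (leaves t) -> x \in leaves t ->
  x = lst t \/ index x (leaves t) < index (lst t) (leaves t).
Proof.
elim: t => [p|y l _ r IHr] /=; first by rewrite inE => _ /eqP; left.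
rewrite cat_uniq mem_cat !index_cat => /and3P[_ /hasPn lr ur].
have /negbTE -> := lr _ (lst_mem r).
have [xl _|xl /= xr] := boolP (x \in leaves l).
  by right; rewrite ltn_addr // index_mem.
by case: (IHr ur xr) => [|h]; [left | right; rewrite ltn_add2l].
Qed.

Lemma cy_between c x : wf c -> x \in leaves (cr1 c) ->
  x = lst (cr1 c) \/ cy (word c) (lst (cl1 c)) x (lst (cr1 c)).
Proof.
move=> wfc xr; have xw : x \in word c by rewrite /word !mem_cat xr orbT.
have lw : lst (cr1 c) \in word c by rewrite /word !mem_cat lst_mem orbT.
have l1w : lst (cl1 c) \in word c by rewrite /word !mem_cat lst_mem.
have [x1 x2 _ _] := blkE wfc xw; have [l1 l2 _ _] := blkE wfc lw.
have [y1 _ _ _] := blkE wfc l1w.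
have u : uniq (leaves (cr1 c)).
  by case/andP: wfc => _; rewrite /word !cat_uniq => /and3P[_ _ /and3P[]].
case: (index_lst u xr) => [|lt]; [by left | right].
have lr := lst_mem (cr1 c); have ll := lst_mem (cl1 c).
rewrite x2 in xr; rewrite l2 in lr; rewrite y1 in ll.
have xl1 : (x \in leaves (cl1 c)) = false by rewrite x1 (eqP xr).
have ll1 : (lst (cr1 c) \in leaves (cl1 c)) = false by rewrite l1 (eqP lr).
rewrite /cy /cyc3 (blk_index wfc l1w xw) ?(eqP ll) ?(eqP xr) //=.
by rewrite /word !index_cat xl1 ll1 x2 l2 xr lr ltn_add2l lt.
Qed.

End Quartets.

Lemma bool_drop (f : nat -> bool) m : f 0 -> ~~ f m ->
  (forall j, j < m -> f j.+1 -> f j) ->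
  exists2 i, i < m & forall j, j <= m -> f j = (j <= i).
Proof.
move=> f0; elim: m => [|m IH]; first by rewrite f0.
move=> fm1 mono; have [fm|fm] := boolP (f m); last first.
  have [j jm|i im fi] := IH fm; first by apply: mono; apply: leqW.
  exists i => [|j]; first exact: leqW.
  rewrite leq_eqVlt => /orP[/eqP->|]; last by rewrite ltnS; apply: fi.
  by rewrite (negbTE fm1) leqNgt ltnS ltnW.
exists m => // j; rewrite leq_eqVlt => /orP[/eqP->|]; first by rewrite (negbTE fm1) ltnn.
rewrite ltnS => jm; rewrite jm; elim: m jm fm mono {IH fm1} => [|m IH].
  by rewrite leqn0 => /eqP->.
rewrite leq_eqVlt => /orP[/eqP->|] //; rewrite ltnS => jm fm mono.
by apply: IH jm _ _ => [|i im]; [apply: mono | apply: mono; apply: leqW].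
Qed.

Lemma bool_lost (f : nat -> bool) i k : i <= k -> f i -> ~~ f k ->
  exists j, [/\ i <= j, j < k, f j & ~~ f j.+1].
Proof.
elim: k => [|k IH]; first by rewrite leqn0 => /eqP-> ->.
rewrite leq_eqVlt => /orP[/eqP->|] fi fk; first by rewrite fi in fk.
have [fk'|fk'] := boolP (f k); first by exists k.
by move: fi fk => /IH{}IH fi _; case: (IH fi fk') => j [? ? ? ?]; exists j; split=> //; apply: leqW.
Qed.

Lemma cyc3_trans i j k l : cyc3 i k j -> cyc3 i j l -> cyc3 i k l.
Proof. by rewrite /cyc3; lia. Qed.

(** * The lower bound *)

Section LowerBound.
Variable W : finType.
Implicit Types (t l : tree W) (c d : center W) (p q r s x : nat) (u v : W).
Variables (E : W -> nat * nat) (c0 : center W).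
Hypotheses (wf0 : wf c0) (ends0 : ctr_ends E c0) (cov0 : forall v, v \in clabels c0).
Notation w0 := (word c0).

(* The original arc [v], turned, joins the blocks [b1] and [b2] of [c]; [supp c] is
   the support of the c-vector at the center of a green [c]. *)
Let link c b1 b2 v : bool :=
  (blk c (E v).1 == b1) && (blk c (E v).2 == b2) ||
  (blk c (E v).1 == b2) && (blk c (E v).2 == b1).

Let supp c : {set W} := [set v | link c 1 3 v].

(** [D i] is the triangulation before step [i], centered at the vertex mutated there. Greenness
    excludes the coordinate -1 at that center, and final redness the coordinate 1 at every edge of
    [D m]. *)
Variables (D : nat -> center W) (m : nat).
Hypotheses (D0 : recenter c0 (D 0))
  (DS : forall i, i < m -> recenter (flip (D i)) (D i.+1))
  (Dgreen : forall i v, i < m -> ~~ link (D i) 0 2 v)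
  (Dred : forall c v, recenter (D m) c -> ~~ link c 1 3 v).

Let ok c := wf c /\ same_cy w0 (word c).

Lemma ok_recenter c c' : ok c -> recenter c c' -> ok c'.
Proof.
move=> [wfc sc] rc; split; first exact: recenter_wf wfc.
exact: same_cy_trans sc (same_cy_recenter rc).
Qed.

Lemma ok_flip c : ok c -> ok (flip c).
Proof.
move=> [wfc sc]; split; first exact: flip_wf.
exact: same_cy_trans sc (same_cy_flip c).
Qed.

Lemma ok0 : ok c0. Proof. by split=> //; split. Qed.

Lemma okD i : i <= m -> ok (D i).
Proof.
elim: i => [_|i IH im]; first exact: ok_recenter ok0 D0.
by apply: ok_recenter (DS im); apply/ok_flip/IH/ltnW.
Qed.

Lemma ok_mem c x : ok c -> (x \in word c) = (x \in w0).
Proof. by case=> _ [pm _]; rewrite (perm_mem pm). Qed.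

Lemma ok_cy c p q r : ok c -> p \in w0 -> q \in w0 -> r \in w0 ->
  cy w0 p q r = cy (word c) p q r.
Proof. by case=> _ [_ h]; apply: h; case/andP: wf0. Qed.

Lemma ok_blk c p q r : ok c -> p \in w0 -> q \in w0 -> r \in w0 ->
  cy w0 p q r -> ~~ cyc3 (blk c p) (blk c r) (blk c q).
Proof.
by move=> okc hp hq hr; rewrite (ok_cy okc) //; apply: cy_blk; rewrite ?(ok_mem _ okc) //; case: okc.
Qed.

Lemma ok_cyc3 c p q r : ok c -> p \in w0 -> q \in w0 -> r \in w0 ->
  cyc3 (blk c p) (blk c q) (blk c r) -> cy w0 p q r.
Proof.
by move=> okc hp hq hr h; rewrite (ok_cy okc) //; apply: blk_cy; rewrite ?(ok_mem _ okc) //; case: okc.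
Qed.

Lemma ok_cyc4 c p q r s : ok c -> p \in w0 -> q \in w0 -> r \in w0 -> s \in w0 ->
  cyc4 w0 p q r s -> cyc4 (word c) p q r s.
Proof. by move=> okc *; rewrite /cyc4 -!(ok_cy okc). Qed.

Lemma lst_w0 c : ok c -> [/\ lst (cl1 c) \in w0, lst (cr1 c) \in w0,
  lst (cl2 c) \in w0 & lst (cr2 c) \in w0].
Proof. by move=> okc; rewrite -!(ok_mem _ okc) /word !mem_cat !lst_mem !orbT. Qed.

Lemma blk_lst c : wf c -> [/\ blk c (lst (cl1 c)) = 0, blk c (lst (cr1 c)) = 1,
  blk c (lst (cl2 c)) = 2 & blk c (lst (cr2 c)) = 3].
Proof.
move=> wfc; have mem t : lst t \in leaves t := lst_mem t.
have inw : [/\ lst (cl1 c) \in word c, lst (cr1 c) \in word c,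
  lst (cl2 c) \in word c & lst (cr2 c) \in word c] by rewrite /word !mem_cat !mem !orbT.
case: inw => /(blkE wfc)[h1 _ _ _] /(blkE wfc)[_ h2 _ _] /(blkE wfc)[_ _ h3 _].
by move=> /(blkE wfc)[_ _ _ h4]; split; apply/eqP; rewrite -?h1 -?h2 -?h3 -?h4 mem.
Qed.

Lemma quartet_step i p q r s : i < m ->
  p \in w0 -> q \in w0 -> r \in w0 -> s \in w0 ->
  ctr_q (D i.+1) p q r s = ctr_q (flip (D i)) p q r s.
Proof.
move=> im hp hq hr hs; have okf := ok_flip (okD (ltnW im)).
rewrite (recenter_q (DS im)) // ?(ok_mem _ okf) //.
by case: okf => /andP[].
Qed.

Lemma quartet_lost_step i p q r s : i < m ->
  p \in w0 -> q \in w0 -> r \in w0 -> s \in w0 -> cyc4 w0 p q r s ->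
  ctr_q (D i) p q r s -> ~~ ctr_q (D i.+1) p q r s ->
  [:: blk (D i) p; blk (D i) q; blk (D i) r; blk (D i) s]
    \in [:: [:: 0; 1; 2; 3]; [:: 2; 3; 0; 1]].
Proof.
move=> im hp hq hr hs c4 h1; have okc := okD (ltnW im); rewrite quartet_step // => h2.
have [wfc _] := okc; apply: (quartet_lost wfc) h1 h2; rewrite ?(ok_mem _ okc) //.
exact: ok_cyc4.
Qed.

(** A topology gained by the flip would be lost by the inverse flip, with [q] and [s] in sides 1 and
    3 of the new quadrilateral. These are sides 0 and 2 of the old one, where [E v] would have
    coordinate -1 at a green vertex. *)
Lemma quartet_kept i p q r s v : i < m ->
  p \in w0 -> q \in w0 -> r \in w0 -> s \in w0 -> cyc4 w0 p q r s ->
  same_ends (E v) q s -> ctr_q (D i.+1) p q r s -> ctr_q (D i) p q r s.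
Proof.
move=> im hp hq hr hs c4 Ev; have okc := okD (ltnW im); have okf := ok_flip okc.
have [wfc _] := okc; have [wff _] := okf; rewrite quartet_step // => h1.
(* Two flips restore the edge with its two sides interchanged, so a flip serves as its own inverse
   up to recentering. *)
have sw : recenter (flip (flip (D i))) (D i).
  by case: (D i) => *; apply/rc_swap/rc_refl.
have okff := ok_flip okf; have uff : uniq (word (flip (flip (D i)))).
  by case: okff => /andP[].
rewrite -(recenter_q sw) ?(ok_mem _ okff) //; apply: contraTT (Dgreen v im) => h2; rewrite negbK.
have := quartet_lost wff _ _ _ _ (ok_cyc4 okf hp hq hr hs c4) h1 h2.
rewrite !(ok_mem _ okf) => /(_ hp hq hr hs); rewrite !blk_flip ?(ok_mem _ okc) //.
rewrite /link; move: (blk_lt4 (D i) q) (blk_lt4 (D i) s).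
case: Ev => -> /=; case: (blk _ q) => [|[|[|[|?]]]] // _; case: (blk _ s) => [|[|[|[|?]]]] // _;
  rewrite !inE !eqseq_cons /= ?andbF //.
Qed.

(* The quadruple of last leaves of [c] changes its topology at step [i] exactly. *)
Definition drops c i : Prop := i < m /\ forall j, j <= m ->
  ctr_q (D j) (lst (cl1 c)) (lst (cr1 c)) (lst (cl2 c)) (lst (cr2 c)) = (j <= i).

Lemma ends_w0 v : (E v).1 \in w0 /\ (E v).2 \in w0.
Proof.
have [c rc <-] := recenter_at (cov0 v); have okc := ok_recenter ok0 rc.
have [[ev _ _] _ _] := recenter_ends rc ends0; have [h1 h2 h3 h4] := lst_w0 okc.
by case: ev => ->.
Qed.

Lemma block_ends c u : ok c -> tree_ends E (cr1 c) (lst (cl1 c)) -> u \in labels (cr1 c) ->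
  forall e, e \in [:: (E u).1; (E u).2] ->
  [|| e == lst (cl1 c), e == lst (cr1 c) | cy w0 (lst (cl1 c)) e (lst (cr1 c))].
Proof.
move=> okc te ul e eu; have [wfc _] := okc; have [h1 h2 _ _] := lst_w0 okc.
have {te ul} : e \in lst (cl1 c) :: leaves (cr1 c).
  have [a1 a2] := tree_ends_mem te ul; move: eu.
  by rewrite !inE => /orP[]/eqP->; rewrite -in_cons.
rewrite inE => /orP[->//|er]; case: (cy_between wfc er) => [->|]; first by rewrite eqxx orbT.
have ew : e \in w0 by rewrite -(ok_mem _ okc) /word !mem_cat er orbT.
by rewrite -(ok_cy okc) // => ->; rewrite !orbT.
Qed.

(** Both ends of the curve lie between [a] and [z], hence in the two adjacent sides containing
    these, and 1 and 3 are not adjacent. *)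
Lemma supp_out d u a z : ok d -> a \in w0 -> z \in w0 ->
  (forall e, e \in [:: (E u).1; (E u).2] -> [|| e == a, e == z | cy w0 a e z]) ->
  (blk d a, blk d z) \in [:: (0, 1); (1, 2); (2, 3); (3, 0)] -> u \notin supp d.
Proof.
move=> okd ha hz he; rewrite inE => baz.
have [h1 h2] := ends_w0 u.
have bnd e : e \in w0 -> [|| e == a, e == z | cy w0 a e z] ->
    [|| blk d e == blk d a, blk d e == blk d z | ~~ cyc3 (blk d a) (blk d z) (blk d e)].
  move=> ew /or3P[/eqP->|/eqP->|/(ok_blk okd ha ew hz)->]; rewrite ?eqxx ?orbT //.
have := bnd _ h1 (he _ (mem_head _ _)); have := bnd _ h2 (he _ _).
rewrite !inE eqxx orbT => /(_ isT); rewrite /link.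
move: (blk_lt4 d (E u).1) (blk_lt4 d (E u).2) baz.
move: (blk d (E u).1) (blk d (E u).2) (blk d a) (blk d z) => b1 b2 ba bz.
case: b1 => [|[|[|[|?]]]] // _; case: b2 => [|[|[|[|?]]]] // _ /=;
by rewrite !inE => /or4P[]/eqP[-> ->].
Qed.

(** The turned arc of [ck c] joins the second and fourth leaves of the quadruple. So [quartet_kept]
    forbids regaining the topology and [quartet_shear] forbids keeping it to the end. Every other
    arc has both ends between two consecutive leaves of the quadruple. *)
Lemma vertex_drop c : recenter c0 c ->
  exists i, drops c i /\ supp (D i) = [set ck c].
Proof.
move=> rc; have okc := ok_recenter ok0 rc; have [wfc _] := okc.
have [h1 h2 h3 h4] := lst_w0 okc; have [b1 b2 b3 b4] := blk_lst wfc.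
have [[ek el1 er1] el2 er2] := recenter_ends rc ends0.
have c4 : cyc4 w0 (lst (cl1 c)) (lst (cr1 c)) (lst (cl2 c)) (lst (cr2 c)).
  by apply/and4P; split; apply: (ok_cyc3 okc) => //; rewrite ?b1 ?b2 ?b3 ?b4.
have uw0 : uniq w0 by case/andP: wf0.
have q0 : ctr_q (D 0) (lst (cl1 c)) (lst (cr1 c)) (lst (cl2 c)) (lst (cr2 c)).
  rewrite -(recenter_q D0) // (recenter_q rc) // ctr_qE ?(ok_mem _ okc) //.
  by rewrite b1 b2 b3 b4.
have qm : ~~ ctr_q (D m) (lst (cl1 c)) (lst (cr1 c)) (lst (cl2 c)) (lst (cr2 c)).
  have okm := okD (leqnn m); have [wfm _] := okm; apply/negP => q1.
  have [|||||c' [rc' s' q']] := quartet_shear wfm _ _ _ _ _ q1; rewrite ?(ok_mem _ okm) //.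
    exact: ok_cyc4.
  have okc' := ok_recenter okm rc'; have [wfc' _] := okc'.
  have sb : blk c' (lst (cr2 c)) == 1.
    by have [|_ <-] := blkE wfc' (p := lst (cr2 c)); rewrite ?(ok_mem _ okc').
  have qb : blk c' (lst (cr1 c)) == 3.
    by have [|_ _ _ <-] := blkE wfc' (p := lst (cr1 c)); rewrite ?(ok_mem _ okc').
  have := Dred (ck c) rc'; rewrite /link.
  by case: ek => -> /=; rewrite (eqP sb) (eqP qb).
have [i im fi] := bool_drop (f := fun j => ctr_q (D j) (lst (cl1 c)) (lst (cr1 c))
  (lst (cl2 c)) (lst (cr2 c))) q0 qm
  (fun j jm => quartet_kept jm h1 h2 h3 h4 c4 ek).
exists i; split; first by split.
have okd := okD (ltnW im).
have lost : [:: blk (D i) (lst (cl1 c)); blk (D i) (lst (cr1 c)); blk (D i) (lst (cl2 c));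
    blk (D i) (lst (cr2 c))] \in [:: [:: 0; 1; 2; 3]; [:: 2; 3; 0; 1]].
  apply: quartet_lost_step => //; first by rewrite fi ?leqnn // ltnW.
  by rewrite fi ?ltnn.
(* [block_ends] speaks of [cr1]; repeated flips rotate the other three sides into that place. *)
have okf := ok_flip okc; have okff := ok_flip okf; have okfff := ok_flip okff.
apply/setP => u; rewrite !inE; have [->|uk] := eqVneq u (ck c).
  move: lost; rewrite /link !inE; case: ek => -> /= /orP[]/eqP[_ -> _ ->] //.
suff: u \notin supp (D i) by rewrite inE => /negbTE.
have := perm_mem (proj1 (recenter_perm rc)) u; rewrite cov0 /clabels inE (negbTE uk) !mem_cat /=.
move/esym/or4P=> [ul|ul|ul|ul].
- apply: (supp_out okd h4 h1 (block_ends okfff el1 ul)).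
  by move: lost; rewrite !inE => /orP[]/eqP[-> _ _ ->].
- apply: (supp_out okd h1 h2 (block_ends okc er1 ul)).
  by move: lost; rewrite !inE => /orP[]/eqP[-> -> _ _].
- apply: (supp_out okd h2 h3 (block_ends okf el2 ul)).
  by move: lost; rewrite !inE => /orP[]/eqP[_ -> -> _].
- apply: (supp_out okd h3 h4 (block_ends okff er2 ul)).
  by move: lost; rewrite !inE => /orP[]/eqP[_ _ -> ->].
Qed.

(* For an arrow [a -> b]: if [b] is crossed before [a], the c-vector [a + b] must
   be crossed in between (the pentagon relation). *)
Lemma arrow_drop a b (P1 P2 P3 P4 P5 : tree W) ia ib :
  recenter c0 (Ctr a P1 P2 (Nd b P3 P4) P5) ->
  drops (Ctr a P1 P2 (Nd b P3 P4) P5) ia -> drops (Ctr b P3 P4 P5 (Nd a P1 P2)) ib ->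
  ib < ia -> exists2 i, i < m & supp (D i) = [set a; b].
Proof.
set c := Ctr a _ _ _ _; set cb := Ctr b _ _ _ _ => rc [iam fa] [ibm fb] iba.
have rcb : recenter c cb by apply/rc_swap/rc_left/rc_refl.
have okc := ok_recenter ok0 rc; have okb := ok_recenter okc rcb.
have [wfc _] := okc; have [wfb _] := okb.
have [h1 h2 _ h5] := lst_w0 okc; have [h3 h4 _ _] := lst_w0 okb.
have [b1 b2 b4 b5] := blk_lst wfc; have [d3 d4 d5 d2] := blk_lst wfb.
have [[ea e1 e2] [eb e3 e4] e5] := recenter_ends rc ends0.
rewrite /= in fa fb h1 h2 h3 h4 h5 b1 b2 b4 b5 d2 d3 d4 d5 ea eb e1 e2 e3 e4 e5.
move: fa fb h1 h2 h3 h4 h5 b1 b2 b4 b5 d2 d3 d4 d5 ea eb e1 e2 e3 e4 e5.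
set p1 := lst P1; set p2 := lst P2; set p3 := lst P3; set p4 := lst P4; set p5 := lst P5.
move=> fa fb h1 h2 h3 h4 h5 b1 b2 b4 b5 d2 d3 d4 d5 ea eb e1 e2 e3 e4 e5.
have b3 : blk c p3 = 2.
  have [|_ _ + _] := blkE wfc (p := p3); first by rewrite (ok_mem _ okc).
  by rewrite /= mem_cat lst_mem => /esym/eqP.
have d1 : blk cb p1 = 3.
  have [|_ _ _] := blkE wfb (p := p1); first by rewrite (ok_mem _ okb).
  by rewrite /= mem_cat lst_mem => /esym/eqP.
have cy512 : cy w0 p5 p1 p2 by apply: (ok_cyc3 okc) => //; rewrite b5 b1 b2.
have cy451 : cy w0 p4 p5 p1 by apply: (ok_cyc3 okc) => //; rewrite b4 b5 b1.
have cy234 : cy w0 p2 p3 p4 by apply: (ok_cyc3 okb) => //; rewrite d2 d3 d4.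
have cy123 : cy w0 p1 p2 p3 by apply: (ok_cyc3 okc) => //; rewrite b1 b2 b3.
have cy341 : cy w0 p3 p4 p1 by apply: (ok_cyc3 okb) => //; rewrite d3 d4 d1.
have cy412 : cy w0 p4 p1 p2 by apply: (ok_cyc3 okc) => //; rewrite b4 b1 b2.
have cy124 : cy w0 p1 p2 p4 by apply: (ok_cyc3 okc) => //; rewrite b1 b2 b4.
have cy245 : cy w0 p2 p4 p5 by apply: (ok_cyc3 okc) => //; rewrite b2 b4 b5.
have cy345 : cy w0 p3 p4 p5 by apply: (ok_cyc3 okb) => //; rewrite d3 d4 d5.
have cy452 : cy w0 p4 p5 p2 by apply: (ok_cyc3 okb) => //; rewrite d4 d5 d2.
have cy523 : cy w0 p5 p2 p3 by apply: (ok_cyc3 okb) => //; rewrite d5 d2 d3.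
have c4a : cyc4 w0 p1 p2 p4 p5 by rewrite /cyc4 cy124 cy245 cy451.
have c4b : cyc4 w0 p3 p4 p5 p2 by rewrite /cyc4 cy345 cy452 cy523.
have c4 : cyc4 w0 p1 p2 p3 p4 by rewrite /cyc4 cy123 cy234 cy341.
have [n12 n45] := cyc4_neq c4a; have [n34 n52] := cyc4_neq c4b.
(* The third quadruple of the pentagon is [p1 p2 | p3 p4]. At step [ib], [p1] lies in the side of
   [p2]: in the side of [p5] it would make this flip destroy [p1 p2 | p4 p5], which survives until
   [ia]. *)
have qb : ctr_q (D ib.+1) p1 p2 p3 p4.
  have okd := okD (ltnW ibm); have [wfd _] := okd; have okf := ok_flip okd.
  have [wff _] := okf.
  have := quartet_lost_step ibm h3 h4 h5 h2 c4b.
  rewrite !fb ?leqnn ?ltnn // 1?ltnW // => /(_ isT isT) lost.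
  have : ctr_q (D ib.+1) p1 p2 p4 p5 by rewrite fa.
  rewrite !quartet_step // ctr_qE ?(ok_mem _ okf) // => qa.
  rewrite ctr_qE ?(ok_mem _ okf) //; apply/orP; right; rewrite inner_q_flip.
  apply: inner_q_same; rewrite ?(ok_mem _ okd) //.
  have {}qa : sepn (blk (flip (D ib)) p1) (blk (flip (D ib)) p2) (blk (flip (D ib)) p4)
      (blk (flip (D ib)) p5) || ((blk (D ib) p1 == blk (D ib) p2) || (blk (D ib) p4 == blk (D ib) p5)).
    case/orP: qa => [->//|]; rewrite inner_q_flip => /inner_q_diff ->; rewrite ?orbT //;
    by rewrite ?(ok_mem _ okd).
  move: qa; rewrite !blk_flip ?(ok_mem _ okd) //.
  move: (ok_blk okd h5 h1 h2 cy512) (blk_lt4 (D ib) p1).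
  move: lost; rewrite !inE => /orP[]/eqP[-> -> -> ->];
  by case: (blk _ p1) => [|[|[|[|?]]]].
(* At step [ia] the quadruple of [b] is already lost, which forces [p3] into the side of [p2]. *)
have qa : ~~ ctr_q (D ia) p1 p2 p3 p4.
  have okd := okD (ltnW iam); have [wfd _] := okd.
  have := quartet_lost_step iam h1 h2 h4 h5 c4a.
  rewrite !fa ?leqnn ?ltnn // 1?ltnW // => /(_ isT isT) lost.
  have : ~~ ctr_q (D ia) p3 p4 p5 p2 by rewrite fb -?ltnNge // ltnW.
  rewrite !ctr_qE ?(ok_mem _ okd) // 2!negb_or => /andP[_ ni].
  have inD p : p \in w0 -> p \in word (D ia) by rewrite (ok_mem _ okd).
  have {}ni := contraNN
    (inner_q_same wfd n34 n52 (inD _ h3) (inD _ h4) (inD _ h5) (inD _ h2)) ni.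
  suff: ~~ sepn (blk (D ia) p1) (blk (D ia) p2) (blk (D ia) p3) (blk (D ia) p4) &&
      ~~ ((blk (D ia) p1 == blk (D ia) p2) || (blk (D ia) p3 == blk (D ia) p4)).
    case/andP=> -> /=; apply: contraNN => /inner_q_diff -> //;
    by rewrite ?(ok_mem _ okd).
  move: ni (ok_blk okd h2 h3 h4 cy234) (blk_lt4 (D ia) p3).
  move: lost; rewrite !inE => /orP[]/eqP[-> -> -> ->];
  by case: (blk _ p3) => [|[|[|[|?]]]].
have [j [ibj jia qj qj1]] := bool_lost (f := fun j => ctr_q (D j) p1 p2 p3 p4) iba qb qa.
have jm : j < m := ltn_trans jia iam.
exists j => //; have okd := okD (ltnW jm); have [wfd _] := okd.
have lost := quartet_lost_step jm h1 h2 h3 h4 c4 qj qj1.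
(* Again because the quadruple of [b] is lost, [p5] lies in the side of [p4]. Then the arcs of [a]
   and of [b] both join sides 1 and 3. *)
have {lost} lost : [:: blk (D j) p1; blk (D j) p2; blk (D j) p3; blk (D j) p4; blk (D j) p5]
    \in [:: [:: 0; 1; 2; 3; 3]; [:: 2; 3; 0; 1; 1]].
  have : ~~ ctr_q (D j) p3 p4 p5 p2 by rewrite fb -?ltnNge // ltnW.
  rewrite ctr_qE ?(ok_mem _ okd) // negb_or => /andP[+ _].
  move: (ok_blk okd h4 h5 h1 cy451) (blk_lt4 (D j) p5).
  move: lost; rewrite !inE => /orP[]/eqP[-> -> -> ->];
  by case: (blk _ p5) => [|[|[|[|?]]]].
apply/setP => u; rewrite !inE; have [->|ua] := eqVneq u a.
  by move: lost; rewrite /link !inE; case: ea => -> /= /orP[]/eqP[_ -> _ _ ->].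
have [->|ub] := eqVneq u b.
  by move: lost; rewrite /link !inE; case: eb => -> /= /orP[]/eqP[_ -> _ -> _].
suff: u \notin supp (D j) by rewrite inE => /negbTE.
have okf := ok_flip okc; have okff := ok_flip okf; have okfff := ok_flip okff.
have okbf := ok_flip okb; have okbfff := ok_flip (ok_flip okbf).
have /or4P[ul|ul|ul|/orP[]ul] : [|| u \in labels P1, u \in labels P2, u \in labels P3,
    u \in labels P4 | u \in labels P5].
  have := perm_mem (proj1 (recenter_perm rc)) u; rewrite cov0 /clabels /=.
  by rewrite !inE (negbTE ua) !mem_cat !inE (negbTE ub) !mem_cat /= -!orbA => <-.
- apply: (supp_out okd h5 h1 (block_ends okfff e1 ul)).
  by move: lost; rewrite !inE => /orP[]/eqP[-> _ _ _ ->].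
- apply: (supp_out okd h1 h2 (block_ends okc e2 ul)).
  by move: lost; rewrite !inE => /orP[]/eqP[-> -> _ _ _].
- apply: (supp_out okd h2 h3 (block_ends okbfff e3 ul)).
  by move: lost; rewrite !inE => /orP[]/eqP[_ -> -> _ _].
- apply: (supp_out okd h3 h4 (block_ends okb e4 ul)).
  by move: lost; rewrite !inE => /orP[]/eqP[_ _ -> -> _].
(* Since [p4] and [p5] share a side, the interval is enlarged to end at [p1], which lies in the
   adjacent side. *)
- apply: (supp_out okd h4 h1); last first.
    by move: lost; rewrite !inE => /orP[]/eqP[-> _ _ -> _].
  move=> e /(block_ends okbf e5 ul) /= /or3P[->//|/eqP->|].
    by rewrite cy451 !orbT.
  by move=> cy4e5; rewrite [cy _ _ e _](cyc3_trans cy4e5 cy451) !orbT.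
Qed.

Lemma triangle_drop (x y z : W) (l1 l2 r1 r2 L R : tree W) :
  recenter c0 (Ctr x (Nd y l1 l2) (Nd z r1 r2) L R) ->
  exists2 i, i < m & supp (D i) \in [:: [set x; y]; [set y; z]; [set z; x]].
Proof.
move=> rc.
have rcx : recenter c0 (Ctr x L R (Nd y l1 l2) (Nd z r1 r2)).
  by apply: recenter_trans rc _; apply/rc_swap/rc_refl.
have rcy : recenter c0 (Ctr y l1 l2 (Nd z r1 r2) (Nd x L R)).
  by apply: recenter_trans rc _; apply/rc_left/rc_refl.
have rcz : recenter c0 (Ctr z r1 r2 (Nd x L R) (Nd y l1 l2)).
  by apply: recenter_trans rc _; apply/rc_right/rc_refl.
have [ix [dx sx]] := vertex_drop rcx; have [iy [dy sy]] := vertex_drop rcy.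
have [iz [dz sz]] := vertex_drop rcz; rewrite /= in sx sy sz.
have [lt|xy] := ltnP iy ix.
  by have [i im si] := arrow_drop rcx dx dy lt; exists i => //; rewrite si !inE eqxx.
have [lt|yz] := ltnP iz iy.
  by have [i im si] := arrow_drop rcy dy dz lt; exists i => //; rewrite si !inE eqxx orbT.
have [lt|zx] := ltnP ix iz.
  by have [i im si] := arrow_drop rcz dz dx lt; exists i => //; rewrite si !inE eqxx !orbT.
(* Without a descent around the cycle the three times coincide, and one step would have two
   different singletons as its support. *)
have e : ix = iy by apply/eqP; rewrite eqn_leq xy (leq_trans yz zx).
have /set1P exy : y \in [set x] by rewrite -sx e sy set11.
have [wfc _] := ok_recenter ok0 rc; have [+ _ _ _] := wf_notin wfc.
by rewrite /= exy mem_head.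
Qed.

Let supps : seq {set W} := [seq supp (D i) | i <- iota 0 m].

(** The pair found for the triangle at the root is contained in neither subtree, while the other
    pairs lie in one of them; so distinct triangles give distinct pairs. *)
Lemma triangle_supps t : forall (k : W) l1 (r1 : tree W) l2 (r2 : tree W), t = Nd k l1 r1 ->
  recenter c0 (Ctr k l1 r1 l2 r2) ->
  exists ps : seq {set W}, [/\ uniq ps, size ps = triangles t, {subset ps <= supps} &
    forall A, A \in ps -> #|A| = 2 /\ {subset A <= labels t}].
Proof.
have mems i : i < m -> supp (D i) \in supps.
  by move=> im; apply: map_f; rewrite mem_iota.
elim: t => // k l IHl l' IHl' k' ? ? l2 r2 [<- <- <-] rc.
have [wfc _] := ok_recenter ok0 rc.
have ut : uniq (labels (Nd k l l')).
  case/andP: wfc => + _; rewrite /clabels /= catA mem_cat cat_uniq negb_or.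
  by move=> /andP[/andP[-> _] /andP[-> _]].
have [kl kl' _ _ dis] := labels_uniq_node ut.
have [ps [ups sps subps Aps]] : exists ps : seq {set W}, [/\ uniq ps, size ps = triangles l,
    {subset ps <= supps} & forall A, A \in ps -> #|A| = 2 /\ {subset A <= labels l}].
  case: l IHl rc {ut kl dis wfc} => [q|y l1 r1] IHl rc; first by exists [::].
  apply: (IHl y l1 r1 l' (Nd k l2 r2)) => //.
  by apply: recenter_trans rc _; apply/rc_left/rc_refl.
have [ps' [ups' sps' subps' Aps']] : exists ps : seq {set W}, [/\ uniq ps,
    size ps = triangles l', {subset ps <= supps} &
    forall A, A \in ps -> #|A| = 2 /\ {subset A <= labels l'}].
  case: l' IHl' rc {ut kl' dis wfc} => [q|y l1 r1] IHl' rc; first by exists [::].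
  apply: (IHl' y l1 r1 (Nd k l2 r2) l) => //.
  by apply: recenter_trans rc _; apply/rc_right/rc_refl.
have upp : uniq (ps ++ ps').
  rewrite cat_uniq ups ups' andbT; apply/hasPn => A A'; apply/negP => /= A1.
  have [c2 s1] := Aps A A1; have [_ s2] := Aps' A A'.
  have /card_gt0P[v vA] : 0 < #|A| by rewrite c2.
  by have := dis v (s1 v vA); rewrite s2.
have subpp : {subset ps ++ ps' <= supps}.
  by move=> A; rewrite mem_cat => /orP[/subps|/subps'].
have App A : A \in ps ++ ps' -> #|A| = 2 /\ {subset A <= labels (Nd k l l')}.
  rewrite mem_cat => /orP[/Aps|/Aps'] [c2 sA]; split=> // v /sA vl; rewrite /= inE mem_cat vl ?orbT //.
have [nn|nn] := boolP (is_node l && is_node l'); last first.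
  by exists (ps ++ ps'); split=> //; rewrite size_cat /= (negbTE nn) sps sps'.
case: l nn rc kl dis App Aps sps ut {IHl wfc} => // y l1 r1 nn rc kl dis App Aps sps ut.
case: l' nn rc kl' dis App Aps' sps' ut {IHl'} => // z l3 r3 nn rc kl' dis App Aps' sps' ut.
have [i im si] := triangle_drop rc.
have yl : y \in labels (Nd y l1 r1) by rewrite /= mem_head.
have zl : z \in labels (Nd z l3 r3) by rewrite /= mem_head.
have ky : k != y by apply: contraNneq kl => ->.
have kz : k != z by apply: contraNneq kl' => ->.
have yz : y != z by apply: contraNneq (dis _ yl) => ->.
have zl' : z \notin labels (Nd y l1 r1) by apply: contraTN zl; apply: dis.
have yl' := dis _ yl.
have [cS [sS [nS nS']]] : #|supp (D i)| = 2 /\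
    {subset supp (D i) <= labels (Nd k (Nd y l1 r1) (Nd z l3 r3))} /\
    ~ {subset supp (D i) <= labels (Nd y l1 r1)} /\
    ~ {subset supp (D i) <= labels (Nd z l3 r3)}.
  have kt : k \in labels (Nd k (Nd y l1 r1) (Nd z l3 r3)) by rewrite mem_head.
  have yt : y \in labels (Nd k (Nd y l1 r1) (Nd z l3 r3)).
    by rewrite -[labels _]/(k :: labels (Nd y l1 r1) ++ labels (Nd z l3 r3)) inE mem_cat yl !orbT.
  have zt : z \in labels (Nd k (Nd y l1 r1) (Nd z l3 r3)).
    by rewrite -[labels _]/(k :: labels (Nd y l1 r1) ++ labels (Nd z l3 r3)) inE mem_cat zl !orbT.
  move: si; rewrite !inE => /or3P[]/eqP->; rewrite cards2 ?ky ?yz 1?eq_sym ?kz //;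
  do !split=> //; try (by move=> v /set2P[]->); move=> sub.
  - by have := sub k (set21 _ _); rewrite (negbTE kl).
  - by have := sub k (set21 _ _); rewrite (negbTE kl').
  - by have := sub z (set22 _ _); rewrite (negbTE zl').
  - by have := sub y (set21 _ _); rewrite (negbTE yl').
  - by have := sub k (set22 _ _); rewrite (negbTE kl).
  - by have := sub k (set22 _ _); rewrite (negbTE kl').
exists (supp (D i) :: ps ++ ps'); split.
- rewrite cons_uniq upp andbT mem_cat negb_or.
  by apply/andP; split; apply/negP; [move=> /Aps[] | move=> /Aps'[]].
- rewrite [size _]/= size_cat sps sps'; by [].
- by move=> A; rewrite inE => /orP[/eqP->|/subpp]; first exact: mems.
- by move=> A; rewrite inE => /orP[/eqP->|/App].
Qed.

(** Distinct supports occur at distinct steps. A pair counted on both sides of the center would be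
    contained in [[set ck c0]]. *)
Lemma ctr_size_le : ctr_size c0 <= m.
Proof.
have rc : recenter c0 (Ctr (ck c0) (cl1 c0) (cr1 c0) (cl2 c0) (cr2 c0)).
  by case: (c0) => *; apply: rc_refl.
have rc' : recenter c0 (Ctr (ck c0) (cl2 c0) (cr2 c0) (cl1 c0) (cr1 c0)).
  by apply: recenter_trans rc _; apply/rc_swap/rc_refl.
have [ps [ups sps subps Aps]] := triangle_supps erefl rc.
have [ps' [ups' sps' subps' Aps']] := triangle_supps erefl rc'.
pose ss := [seq [set v] | v <- clabels c0] : seq {set W}.
have uc : uniq (clabels c0) by case/andP: wf0.
have uss : uniq (ss ++ ps ++ ps').
  rewrite cat_uniq map_inj_uniq; last exact: set1_inj.
  rewrite uc /= cat_uniq ups ups' andbT; apply/andP; split.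
    apply/hasPn => A; rewrite mem_cat => Ap; apply/negP => /mapP[v _ eA].
    by case/orP: Ap => [/Aps|/Aps'] []; rewrite eA cards1.
  apply/hasPn => A A'; apply/negP => /= A1.
  have [c2 s1] := Aps A A1; have [_ s2] := Aps' A A'.
  have [u4 n1 n2 n3] := wf_notin wf0.
  have /subset_leq_card : A \subset [set ck c0].
    apply/subsetP => v vA; rewrite inE; have := s1 v vA; have := s2 v vA.
    rewrite /= !inE; case: eqP => //= _ v2 v1; move: uc.
    rewrite /clabels cons_uniq catA cat_uniq => /and3P[_ _ /andP[/hasPn h _]].
    by have := h v v2; rewrite /= v1.
  by rewrite cards1 c2.
have sub : {subset ss ++ ps ++ ps' <= supps}.
  move=> A; rewrite !mem_cat => /or3P[/mapP[v _ ->]|/subps|/subps'] //.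
  have [c rcv <-] := recenter_at (cov0 v); have [i [[im _] <-]] := vertex_drop rcv.
  by apply: map_f; rewrite mem_iota.
have := uniq_leq_size uss sub; rewrite !size_cat !size_map size_iota sps sps'.
by rewrite /ctr_size addnA.
Qed.

End LowerBound.

(** * From green mutation sequences to sequences of flips *)

Section Trajectory.
Variable W : finType.
Local Open Scope ring_scope.

(** Before each step the triangulation is recentered at the vertex about to be mutated. The last one
    has no preferred center, so redness is later tested on all its recenterings. *)
Lemma trajectory (E : W -> nat * nat) s M (c : center W) :
  wf c -> (forall v, v \in clabels c) -> rep E M c -> greens predT M s ->
  exists D : nat -> center W, [/\ recenter c (D 0%N),
    forall i, (i < size s)%N -> recenter (flip (D i)) (D i.+1),
    forall i, (i < size s)%N -> wf (D i) /\ forall v, 0 <= ctr_c (D i) (ck (D i)) (E v),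
    wf (D (size s)) & rep E (mus M s) (D (size s))].
Proof.
elim: s M c => [|k s IH] M c wfc cov rM /=.
  by exists (fun=> c); split=> //; apply: rc_refl.
move=> [gk gs]; have [c1 rc ck1] := recenter_at (cov k).
have wf1 := recenter_wf rc wfc; have r1 := rep_recenter rc rM.
have r2 := rep_flip wf1 r1; rewrite ck1 in r2.
have [|D [D0 DS Dg wfm rm]] := IH _ _ (flip_wf wf1) _ r2 gs.
  move=> v; rewrite -(perm_mem (proj1 (flip_perm c1))).
  by rewrite -(perm_mem (proj1 (recenter_perm rc))).
exists (fun i => if i is j.+1 then D j else c1); split=> //.
- by move=> [|i] //= im; apply: DS.
- move=> [|i] //= im; last exact: Dg.
  by split=> // v; rewrite -(rep_c r1) ck1; apply: gk.
Qed.

Lemma ctr_mgs_size (b : W -> W -> int) (c : center W) s :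
  skew_sym b -> wf c -> (forall v, v \in clabels c) ->
  (forall i j, b i j = ctr_mx c i j) -> mgs b predT s -> (ctr_size c <= size s)%N.
Proof.
move=> skb wfc cov bE [_ gs fin].
have [E Ec] := ctr_ends_ex wfc.
have [D [D0 DS Dg wfm rm]] := trajectory wfc cov (rep_framed skb wfc Ec cov bE) gs.
have shear d v : wf d -> (E v).1 \in word d -> (E v).2 \in word d ->
    ctr_c d (ck d) (E v) =
    ((blk d (E v).1 == 1%N) && (blk d (E v).2 == 3%N) ||
     (blk d (E v).1 == 3%N) && (blk d (E v).2 == 1%N))%:Z -
    ((blk d (E v).1 == 0%N) && (blk d (E v).2 == 2%N) ||
     (blk d (E v).1 == 2%N) && (blk d (E v).2 == 0%N))%:Z.
  move=> wfd h1 h2; rewrite ctr_c_center // /joins.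
  have : uniq (word d) by case/andP: wfd.
  rewrite /word !cat_uniq => /and3P[u1 _ /and3P[u2 _ /and3P[u3 _ u4]]].
  rewrite !lv_mem //; have [-> -> -> ->] := blkE wfd h1; have [-> -> -> ->] := blkE wfd h2.
  by case: (blk d (E v).1) => [|[|[|[|?]]]]; case: (blk d (E v).2) => [|[|[|[|?]]]].
have ew c' v : recenter c c' -> (E v).1 \in word c' /\ (E v).2 \in word c'.
  move=> rc; rewrite -!(perm_mem (proj2 (recenter_perm rc))).
  exact: (ends_w0 wfc Ec cov).
have okD i : (i <= size s)%N -> perm_eq (word c) (word (D i)).
  elim: i => [_|i IH im]; first by have [] := recenter_perm D0.
  apply: perm_trans (IH (ltnW im)) _; apply: perm_trans (proj2 (flip_perm _)) _.
  by have [] := recenter_perm (DS i im).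
have ewD i v : (i <= size s)%N -> (E v).1 \in word (D i) /\ (E v).2 \in word (D i).
  by move=> /okD pm; rewrite -!(perm_mem pm); apply: ew; apply: rc_refl.
apply: (ctr_size_le wfc Ec cov D0 DS).
- move=> i v im; have [wfi gi] := Dg i im; have [h1 h2] := ewD i v (ltnW im).
  apply/negP => lk; have := gi v; rewrite shear // lk.
  by case/orP: lk => /andP[/eqP-> /eqP->].
- move=> c' v rc; have [h1 h2] := ewD _ v (leqnn _).
  rewrite !(perm_mem (proj2 (recenter_perm rc))) in h1 h2.
  apply/negP => lk; have := fin (ck c') v isT isT.
  rewrite /run (rep_c (rep_recenter rc rm)) shear ?(recenter_wf rc wfm) // lk.
  by case/orP: lk => /andP[/eqP-> /eqP->].
Qed.

End Trajectory.

(** * Translation between quivers and matrices, and the final gluing *)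

Section FramedMgs.
Local Open Scope ring_scope.

Lemma qmx_ge0 (V : finType) (Q : quiver V) u v : 0 <= qmx Q u v <-> Q v u = 0%N.
Proof. by rewrite /qmx; case: (no_2cycle Q u v); split; lia. Qed.

Lemma qmx_le0 (V : finType) (Q : quiver V) u v : qmx Q u v <= 0 <-> Q u v = 0%N.
Proof. by rewrite /qmx; case: (no_2cycle Q u v); split; lia. Qed.

Lemma greens_prefix (V : eqType) (T : pred V) b s :
  greens T (framed_mx b) s <-> forall s1 k s2, s = s1 ++ k :: s2 ->
    forall g, T g -> 0 <= run b s1 (inl k) (inr g).
Proof.
split=> [gs s1 k s2 e|]; first by move: gs; rewrite e => /greens_cat[_ []].
elim/last_ind: s => // s k IH gs; apply/greens_rcons; split.
  by apply: IH => s1 k' s2 e; apply: (gs s1 k' (rcons s2 k)); rewrite e rcons_cat.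
by apply: (gs s k [::]); rewrite cats1.
Qed.

Lemma maximal_green_sequenceP (V : finType) (Q : quiver V) s :
  maximal_green_sequence Q s <-> mgs (qmx Q) predT s.
Proof.
have runE s' i j : run (qmx Q) s' (inl i) (inr j) = qmx (framed_mutates Q s') (inl i) (inr j).
  by rewrite qmx_framed_mutates.
split=> [[gs rs]|[_ /greens_prefix gs rs]]; split.
- exact/allP.
- by apply/greens_prefix => s1 k s2 e g _; rewrite runE; apply/qmx_ge0/(gs s1 k s2 e).
- by move=> i f _ _; rewrite runE; apply/qmx_le0/rs.
- by move=> s1 i s2 e j; apply/qmx_ge0; rewrite -runE (gs s1 i s2 e).
- by move=> i j; apply/qmx_le0; rewrite -runE rs.
Qed.

Lemma full_subquiverP (V : finType) (Q : quiver V) (S : {set V}) s :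
  mgs (qmx (full_subquiver Q S)) predT s <-> mgs (qmx Q) (fun v => v \in S) (map val s).
Proof.
apply: mgs_map => //; first exact: val_inj.
- by move=> i; apply: (valP i).
- by move=> v vS; exists (exist _ v vS).
Qed.

(** The lower bound applied to a shortest sequence and the minimality of [n] applied to the special
    one give [ctr_size c = n]. *)
Lemma typeA_min_source (V : finType) (Q : quiver V) (S : {set V}) (x : V) n :
  x \in S -> mutation_type_A (full_subquiver Q S) ->
  minimal_mgs_length (full_subquiver Q S) n ->
  exists s1 s2, mgs_source (qmx Q) (fun v => v \in S) x s1 s2 /\
    (size s1 + size s2).+1 = n.
Proof.
move=> xS tA [[s ms sn] nmin].
have skQ := skew_qmx (full_subquiver Q S).
have [c [wfc cx cov cE]] := typeA_center (exist (fun v => v \in S) x xS) tA.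
have [s1 [s2 [m12 sz]]] := ctr_mgs skQ wfc cov cE.
have cn : ctr_size c = n.
  apply/eqP; rewrite eqn_leq; apply/andP; split.
    rewrite -sn; apply: (ctr_mgs_size skQ wfc cov cE).
    exact/maximal_green_sequenceP.
  have [m1 _ _ _] := m12; move/maximal_green_sequenceP/nmin: m1.
  by rewrite size_cat /= addnS sz.
exists (map val s1), (map val s2); split; last by rewrite !size_map sz.
have -> : x = val (ck c) by rewrite cx.
apply: mgs_source_map m12 => //; first exact: val_inj.
- by move=> i; apply: (valP i).
- by move=> v vS; exists (exist _ v vS).
Qed.

End FramedMgs.

Theorem theorem5p4 (V : finType) (Qt : quiver V) (k : nat)
    (Q0 : {set V}) (Qi0 : 'I_k -> {set V}) (x : 'I_k -> V)
    (hcover : Q0 :|: \bigcup_(i < k) Qi0 i = [set: V])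
    (hconnQ : connected_quiver (full_subquiver Qt Q0))
    (hconnQi : forall i, connected_quiver (full_subquiver Qt (Qi0 i)))
    (h1 : forall i, Qi0 i :&: Q0 = [set x i])
    (h2 : forall i j, i != j ->
       Qi0 i :&: Qi0 j = if x i == x j then [set x i] else set0)
    (h3 : forall (i : 'I_k) (u v : V), 0 < Qt u v ->
       (u \in Qi0 i :\ x i -> v \in Qi0 i) /\
       (v \in Qi0 i :\ x i -> u \in Qi0 i))
    (h4 : forall i, mutation_type_A (full_subquiver Qt (Qi0 i)))
    (muQ : seq {v : V | v \in Q0})
    (hmuQ : maximal_green_sequence (full_subquiver Qt Q0) muQ)
    (lmin : 'I_k -> nat)
    (hlmin : forall i, minimal_mgs_length (full_subquiver Qt (Qi0 i)) (lmin i)) :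
  exists2 s : seq V, maximal_green_sequence Qt s &
    size s = size muQ + \sum_(i < k) lmin i - k.
Proof.
have [xQi xQ0] : (forall i, x i \in Qi0 i) /\ (forall i, x i \in Q0).
  by split=> i; have := set11 (x i); rewrite -h1 inE => /andP[].
pose S (js : seq 'I_k) v := (v \in Q0) || has (fun j => v \in Qi0 j) js.
(* The [Q^i] are glued one at a time to what has been built so far, each saving one mutation; the
   additive form of the length avoids truncated subtraction. *)
have glue js : uniq js -> exists2 s, mgs (qmx Qt) (S js) s &
    size s + size js = size muQ + \sum_(j <- js) lmin j.
  elim: js => [_|j js IH /= /andP[jjs ujs]].
    exists (map val muQ); last by rewrite size_map big_nil.
    apply: (@eq_mgs _ _ (fun v => v \in Q0)); first by move=> v; rewrite /S orbF.
    exact/full_subquiverP/maximal_green_sequenceP.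
  have [s ms sz] := IH ujs.
  have [s1 [s2 [m12 sz12]]] := typeA_min_source (xQi j) (h4 j) (hlmin j).
  have meet v : S js v -> v \in Qi0 j -> v = x j.
    move=> + vj; case/orP=> [vQ|/hasP[i ijs vi]].
      by apply/set1P; rewrite -h1 inE vj.
    have ji : j != i by apply: contraNneq jjs => ->.
    have : v \in Qi0 j :&: Qi0 i by rewrite inE vj.
    by rewrite h2 //; case: ifP => _; rewrite inE // => /eqP.
  (* An arrow between [v] and [u] would, by (3), put [u] into [Q^j], where only [x j] belongs to the
     part already built. *)
  have cross u v : S js u -> u != x j -> v \in Qi0 j -> v != x j -> qmx Qt u v = 0%R.
    move=> Su ux vj vx; have uj : u \notin Qi0 j by apply: contraNN ux => /(meet _ Su)->.
    have vj' : v \in Qi0 j :\ x j by rewrite !inE vx.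
    have zero : Qt u v = 0 /\ Qt v u = 0.
      split; apply/eqP; rewrite -leqn0 leqNgt; apply: contraNN uj => /h3-/(_ j)[].
        by move=> _; apply.
      by move=> + _; apply.
    by rewrite /qmx; case: zero => -> ->.
  exists (s1 ++ s ++ s2); last first.
    rewrite !size_cat big_cons -sz12 /=.
    move: sz; move: (bigop _ _ _) (size js) (size s) (size s1) (size s2) (size muQ).
    by clear; lia.
  apply: (@eq_mgs _ _ (fun v => S js v || (v \in Qi0 j))).
    by move=> v; rewrite /S /= -orbA (orbC (has _ _)).
  apply: (mgs_glue (w := x j) _ (xQi j) meet (skew_qmx Qt) cross m12 ms).
  by rewrite /S xQ0.
have [s ms sz] := glue _ (enum_uniq 'I_k).
exists s.
  apply/maximal_green_sequenceP; apply: eq_mgs ms => v.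
  suff -> : S (enum 'I_k) v by [].
  have : v \in Q0 :|: \bigcup_(i < k) Qi0 i by rewrite hcover in_setT.
  rewrite inE /S => /orP[->//|/bigcupP[i _ vi]]; apply/orP; right.
  by apply/hasP; exists i; rewrite ?mem_enum.
by rewrite big_enum size_enum_ord /= in sz; rewrite -sz addnK.
Qed.
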